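(* Let $\sigma>1$, and for $\tau>0$ let $M_p^{\tau,\sigma}=p^{\tau p^\sigma}$ for $p\in\mathbb N$, $M_0^{\tau,\sigma}=1$, and let $\mathcal M_\sigma=\{(M_p^{\tau,\sigma})_{p\in\mathbb N_0}:\tau>0\}$. Let $\varphi\in C^\infty(\mathbb R^n)$. Then the following conditions are equivalent: 1. $\varphi\in\mathcal S_{\{\mathcal M_\sigma\}}^{\{\mathcal M_\sigma\}}(\mathbb R^n)$; 2. $(\exists\tau>0)(\exists C>0)(\forall\alpha,\beta\in\mathbb N_0^n)$ $$\sup_x|x^\alpha\varphi(x)|\le C M^{\tau,\sigma}_{|\alpha|}\quad\text{and}\quad\sup_x|\partial^\beta\varphi(x)|\le C M^{\tau,\sigma}_{|\beta|};$$ 3. $(\exists\tau>0)(\exists C>0)(\forall\alpha,\beta\in\mathbb N_0^n)$ $$\sup_x|x^\alpha\varphi(x)|\le C M^{\tau,\sigma}_{|\alpha|}\quad\text{and}\quad\sup_\xi|\xi^\beta\widehat\varphi(\xi)|\le C M^{\tau,\sigma}_{|\beta|}.$$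
   Context: For $\varphi\in C^\infty(\mathbb R^n)$: $\varphi\in\mathcal S_{\{\mathcal M_\sigma\}}^{\{\mathcal M_\sigma\}}(\mathbb R^n)$ iff $(\exists\tau>0)(\exists C>0)(\forall\alpha,\beta\in\mathbb N_0^n)\ \sup_{x\in\mathbb R^n}|x^\alpha\partial^\beta\varphi(x)|\le C M^{\tau,\sigma}_{|\alpha|}M^{\tau,\sigma}_{|\beta|}$. The Fourier transform is $\widehat\varphi(\xi)=\int_{\mathbb R^n}\varphi(x)e^{-2\pi i x\xi}\,dx$, $\xi\in\mathbb R^n$. In condition 3 the first estimate guarantees $\varphi\in L^1(\mathbb R^n)$, so that $\widehat\varphi$ is well defined. Suprema are over $\mathbb R^n$. *)

(* Defs.v *)
From HB Require Import structures.
From mathcomp Require Import all_boot all_order all_algebra.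
From mathcomp Require Import all_classical all_reals all_analysis.
From mathcomp.real_closed Require Import complex.
Import Order.TTheory GRing.Theory Num.Theory.
Import numFieldNormedType.Exports.

Set Implicit Arguments.
Unset Strict Implicit.
Unset Printing Implicit Defensive.

Local Open Scope classical_set_scope.
Local Open Scope ring_scope.

Section weight_sequence.
Context {R : realType}.

Definition weight (tau sigma : R) (p : nat) : R :=
  if p is 0%N then 1 else p%:R `^ (tau * p%:R `^ sigma).

End weight_sequence.

(* [n.-tuple (measurableTypeR R)] is R^n with its Borel sigma-algebra (the
   product one): the library puts no measurable structure on ['rV[R]_n]. *)
Section lebesgue_tuple.
Context {R : realType}.
Local Notation Rn n := (n.-tuple (measurableTypeR R)).

Section cons.
Variable n : nat.

Definition tuple_cons (p : measurableTypeR R * Rn n) : Rn n.+1 :=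
  [the n.+1.-tuple (measurableTypeR R) of p.1 :: p.2].

Lemma measurable_tuple_cons : measurable_fun [set: _] tuple_cons.
Proof. exact: measurable_cons. Qed.

Variable mu : {sigma_finite_measure set (Rn n) -> \bar R}.

Definition lebesgue_cons : set (Rn n.+1) -> \bar R :=
  pushforward (lebesgue_measure \x mu)%E tuple_cons.

Let measurable_preimage A :
  measurable A -> measurable (tuple_cons @^-1` A).
Proof.
by move=> mA; rewrite -[X in measurable X]setTI; exact: measurable_tuple_cons.
Qed.

Let lebesgue_cons0 : lebesgue_cons set0 = 0%E.
Proof. by rewrite /lebesgue_cons /pushforward preimage_set0 measure0. Qed.

Let lebesgue_cons_ge0 A : (0 <= lebesgue_cons A)%E.
Proof. by rewrite /lebesgue_cons /pushforward measure_ge0. Qed.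

Let lebesgue_cons_sigma_additive : semi_sigma_additive lebesgue_cons.
Proof.
move=> F mF tF mUF; rewrite /lebesgue_cons /pushforward preimage_bigcup.
apply: measure_semi_sigma_additive.
- by move=> k; exact: measurable_preimage.
- apply/trivIsetP => /= i j _ _ ij; rewrite -preimage_setI.
  by move/trivIsetP : tF => /(_ _ _ _ _ ij) ->//; rewrite preimage_set0.
- by rewrite -preimage_bigcup; exact: measurable_preimage.
Qed.

HB.instance Definition _ := isMeasure.Build _ _ _ lebesgue_cons
  lebesgue_cons0 lebesgue_cons_ge0 lebesgue_cons_sigma_additive.

Let lebesgue_cons_sigma_finite : sigma_finite setT lebesgue_cons.
Proof.
have /sigma_finiteP[F [FT ndF Foo]] :=
  @sigma_finiteT _ _ _ (@lebesgue_measure R).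
have /sigma_finiteP[G [GT ndG Goo]] := sigma_finiteT mu.
pose g (t : Rn n.+1) : measurableTypeR R * Rn n :=
  (thead t, [tuple of behead t]).
have gK (p : measurableTypeR R * Rn n) : g (tuple_cons p) = p.
  by case: p => x t; rewrite /g /tuple_cons /=; congr pair; exact: val_inj.
have mg : measurable_fun [set: Rn n.+1] g.
  apply/measurable_fun_pairP; split.
    exact: (@measurable_tnth _ (measurableTypeR R) n.+1 ord0).
  exact: (@measurable_behead _ (measurableTypeR R) n).
exists (fun k => g @^-1` (F k `*` G k)).
  apply/esym; rewrite -subTset => t _.
  have [i _ Fi] : (\bigcup_i F i) (g t).1 by rewrite -FT.
  have [j _ Gj] : (\bigcup_i G i) (g t).2 by rewrite -GT.
  exists (maxn i j) => //; split.
    by move: Fi; exact/subsetPset/ndF/leq_maxl.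
  by move: Gj; exact/subsetPset/ndG/leq_maxr.
move=> k; have [mF Fkoo] := Foo k; have [mG Gkoo] := Goo k; split.
  by rewrite -[X in measurable X]setTI; apply: mg => //; exact: measurableX.
have -> : lebesgue_cons (g @^-1` (F k `*` G k)) =
    (lebesgue_measure \x mu)%E (F k `*` G k).
  rewrite /lebesgue_cons /pushforward -comp_preimage.
  by rewrite (_ : g \o tuple_cons = id) ?preimage_id//; exact/funext.
by rewrite product_measure1E// lte_mul_pinfty// ge0_fin_numE.
Qed.

HB.instance Definition _ := Measure_isSigmaFinite.Build _ _ _
  lebesgue_cons lebesgue_cons_sigma_finite.

End cons.

Fixpoint lebesgue_tuple (n : nat) :
    {sigma_finite_measure set (Rn n) -> \bar R} :=
  match n with
  | 0%N => [the {sigma_finite_measure set (Rn 0) -> \bar R} of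
             dirac ([tuple] : Rn 0)]
  | m.+1 => [the {sigma_finite_measure set (Rn m.+1) -> \bar R} of
             lebesgue_cons (lebesgue_tuple m)]
  end.

(* This characterizes [lebesgue_tuple n] as the n-dimensional Lebesgue
   measure. *)
Lemma lebesgue_tuple_box n (A : 'I_n -> set (measurableTypeR R)) :
  (forall j, measurable (A j)) ->
  lebesgue_tuple n [set t | forall j, A j (tnth t j)] =
  (\prod_(j < n) lebesgue_measure (A j))%E.
Proof.
elim: n A => [|n IH] A mA.
  rewrite big_ord0 /= diracE mem_set//.
  by case.
rewrite big_ord_recl -IH; last by [].
rewrite -product_measure1E//; last first.
  rewrite (_ : mkset _ = \bigcap_(j in [set: 'I_n])
      ((fun t : Rn n => tnth t j) @^-1` A (lift ord0 j))).
    apply: fin_bigcap_measurable => // j _; rewrite -[X in measurable X]setTI.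
    exact: measurable_tnth.
  by apply/seteqP; split=> t /= h j; [move=> _|]; exact: h.
rewrite /lebesgue_tuple -/lebesgue_tuple /= /lebesgue_cons /pushforward.
congr ((_ \x _)%E _); apply/seteqP; split=> -[x t] /=.
  by move=> h; split=> [|j]; [exact: (h ord0)|have := h (lift ord0 j); rewrite tnthS].
move=> [hx ht] j; case: (unliftP ord0 j) => [k ->|->]; last exact: hx.
by rewrite tnthS; exact: ht.
Qed.

End lebesgue_tuple.

Section functions_on_Rn.
Context {R : realType} {n : nat}.
Local Notation Rn := 'rV[R]_n.
Implicit Types (f : Rn -> R) (phi : Rn -> R[i]) (a b : {ffun 'I_n -> nat}).

Definition mlength a : nat := \sum_(j < n) a j.

Definition monomial a (x : Rn) : R := \prod_(j < n) x ord0 j ^+ a j.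

Definition partial (j : 'I_n) f : Rn -> R := 'D_(delta_mx ord0 j) f.

(* All iterated partial derivatives, in any order, exist and are
   continuous. *)
Definition smooth_real f : Prop :=
  forall s : seq 'I_n, let g := foldr partial f s in
    continuous g /\ forall (j : 'I_n) (x : Rn), derivable g x (delta_mx ord0 j).

(* Complex-valued functions are differentiated and integrated componentwise:
   the library has no structure of normed space over [R] on [R[i]]. *)
Definition smooth phi : Prop :=
  smooth_real (fun x => complex.Re (phi x)) /\ smooth_real (fun x => complex.Im (phi x)).

Definition mpartial_real b f : Rn -> R :=
  foldr (fun j => iter (b j) (partial j)) f (enum 'I_n).

Definition mpartial b phi (x : Rn) : R[i] :=
  (mpartial_real b (fun y => complex.Re (phi y)) x +i*
   mpartial_real b (fun y => complex.Im (phi y)) x)%C.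

(* [Normc.normc] is the modulus with values in [R]; the norm [`|z|] of
   [R[i]] is its image in [R[i]]. *)
Definition supnorm phi : \bar R :=
  ereal_sup (range (fun x : Rn => (Normc.normc (phi x))%:E)).

Definition tuple_row (t : n.-tuple (measurableTypeR R)) : Rn :=
  \row_j tnth t j.

Definition integral_Rn phi : R[i] :=
  (Rintegral (lebesgue_tuple n) setT (fun t => complex.Re (phi (tuple_row t))) +i*
   Rintegral (lebesgue_tuple n) setT (fun t => complex.Im (phi (tuple_row t))))%C.

Definition dot (x y : Rn) : R := \sum_(j < n) x ord0 j * y ord0 j.

Definition expi (t : R) : R[i] := (cos t +i* sin t)%C.

Definition fourier phi (xi : Rn) : R[i] :=
  integral_Rn (fun x => phi x * expi (- (2 * pi * dot x xi))).

(* The space S_{M_sigma}^{M_sigma}(R^n) of Roumieu type. *)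
Definition gelfand_shilov (sigma : R) : set (Rn -> R[i]) :=
  [set phi | smooth phi /\
    exists2 tau : R, 0 < tau & exists2 C : R, 0 < C &
      forall a b, (supnorm (fun x => (monomial a x)%:C%C * mpartial b phi x)%R <=
        (C * weight tau sigma (mlength a) * weight tau sigma (mlength b))%:E)%E].

End functions_on_Rn.

(* Main.v *)
Require Import Defs.
From HB Require Import structures.
From mathcomp Require Import all_boot all_order all_algebra.
From mathcomp Require Import all_classical all_reals all_analysis.
From mathcomp Require Import measurable_realfun.
From mathcomp.real_closed Require Import complex.
From mathcomp Require Import ring lra.
Import Order.TTheory GRing.Theory Num.Theory.
Import numFieldNormedType.Exports.
Local Open Scope classical_set_scope.
Local Open Scope ring_scope.

Set Implicit Arguments.
Unset Strict Implicit.
Unset Printing Implicit Defensive.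

(** The hypothesis sigma > 1 enters through one fact: p^sigma ln p dominates
    both p and p ln p. Hence, in an estimate by the weights p^(tau p^sigma),
    factors such as A^p and p^(Cp), powers, and the passage from p to Np or
    p + m only change tau and the constant; [tame] collects these closure
    properties. Every estimate below is allowed such losses.

    Conditions 1 and 2. From 1 to 2 take a zero multi-index. Conversely, let
    |g| <= A and |g^(m)| <= B on a half line. Then, for k <= m and every step
    h > 0, |g^(k)| h^k <= K_m (A + B h^m) with K_m of the size of m^(Cm)
    ([chain_bound]): a k-th difference of step h produces a point where g^(k)
    is small, and the next derivative controls the variation from there.
    This is applied in one coordinate after the other, on the orthant with
    vertex x that points away from the origin ([landau_blocks]). On it
    |y^alpha| >= |x^alpha|, so that the decay of phi gives
    |phi| <= (a / |x^alpha|)^2 with a of the size of the weight at 2 |alpha|;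
    the derivatives of order 2 |beta| are bounded by some b^2. The best h yields
    |x^alpha d^beta phi(x)| <= K a b ([mixed_bound]), which is condition 1.

    From 2 to 3. By the mixed estimate the derivatives of phi are dominated by
    multiples of the integrable function prod_j 1/(1 + x_j^2) ([decay]), and
    (2 pi i xi)^beta times the transform of phi is the transform of
    d^beta phi ([int_partials_wave]).

    From 3 to 2. Now phi and its transform are both dominated by [decay], so
    that phi is recovered by Fourier inversion ([fourier_inversion]), and
    differentiation under the integral sign bounds its derivatives by the
    integrals of |xi^beta| times the transform ([partials_growth]). Inversion
    is proved with the summability kernel exp(- |xi_1| - ... - |xi_n|), whose
    transform prod_j 2/(1 + z_j^2) is elementary.

    All integrals are real: the exponentials are replaced by the functions
    [wave] c x xi = cos (c + 2 pi x.xi). Differentiation in x multiplies by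
    2 pi xi_j and adds pi/2 to the phase c, so that derivatives of all orders
    stay in this family. *)

(** * Measurability of continuous functions on R^n *)

Section measurability.
Context {R : realType} (n : nat).
Local Notation Rn := 'rV[R]_n.

(** An open set is the union of the open cubes with rational centre and radius
    1/(k+1) that it contains; there are countably many of these, and each of them
    is a box, hence measurable for the product sigma-algebra. *)
Lemma measurable_preimage_open (U : set Rn) : open U ->
  measurable (@tuple_row R n @^-1` U).
Proof.
move=> oU.
pose cube (q : n.-tuple rat * nat) :=
  [set t : n.-tuple (measurableTypeR R) |
   forall j, `|tnth t j - ratr (tnth q.1 j)| < q.2.+1%:R^-1].
pose C (q : n.-tuple rat * nat) :=
  if pselect (cube q `<=` @tuple_row R n @^-1` U) then cube q else set0.
rewrite (_ : _ @^-1` _ = \bigcup_q C q).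
  apply: countable_bigcupT_measurable => [|q].
    by exact: countableP.
  rewrite /C; case: (pselect _) => ? /=; last exact: measurable0.
  rewrite (_ : cube q = \bigcap_(j in [set: 'I_n])
      ((fun t : n.-tuple (measurableTypeR R) => tnth t j) @^-1`
        [set x : R | `|x - ratr (tnth q.1 j)| < q.2.+1%:R^-1])); last first.
    by apply/seteqP; split => t /= h j; [move=> _|]; exact: h.
  apply: fin_bigcap_measurable => // j _.
  rewrite -[X in measurable X]setTI.
  apply: (measurable_tnth j) => //.
  apply: open_measurable.
  rewrite (_ : [set _ | _] = ball (ratr (tnth q.1 j) : R) q.2.+1%:R^-1).
    exact: ball_open.
  by apply/seteqP; split => x /=; rewrite /ball /= distrC.
apply/seteqP; split => t; last first.
  by move=> [q _]; rewrite /C; case: (pselect _) => // qU; exact: qU.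
move=> /= Ut.
have /nbhs_ballP[e /= e0 eU] : nbhs (tuple_row t) U by exact: open_nbhs_nbhs.
have [k ke] : exists k : nat, k.+1%:R^-1 < e / 2.
  have e2 : 0 < e / 2 by exact: divr_gt0.
  have /filter_ex[k hk] := near_infty_natSinv_lt (PosNum e2).
  by exists k.
have H j : exists q : rat, `|tnth t j - ratr q| < k.+1%:R^-1.
  have := @rat_in_itvoo R (tnth t j - k.+1%:R^-1) (tnth t j + k.+1%:R^-1).
  case.
    by rewrite ltrD2l (@lt_trans _ _ 0)// ?oppr_lt0 invr_gt0.
  move=> q; rewrite in_itv /= => /andP[q1 q2]; exists q.
  by rewrite distrC ltr_distl q1.
have [q hq] := choice H.
exists ([tuple q j | j < n], k) => //.
have tC : cube ([tuple q j | j < n], k) t.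
  by move=> j /=; rewrite tnth_mktuple.
rewrite /C; case: (pselect _) => // -[] u uC; apply: eU.
split=> // i j; rewrite /ball /= !mxE.
have := uC j; have := tC j; rewrite /= tnth_mktuple => h1 h2.
apply: (le_lt_trans (ler_distD (ratr (q j)) _ _)).
rewrite [X in _ < X]splitr [X in _ + X]distrC.
by apply: ltrD; [exact: lt_trans h1 _|exact: lt_trans h2 _].
Qed.

Lemma continuous_measurable_tuple (f : Rn -> R) : continuous f ->
  measurable_fun setT (f \o @tuple_row R n).
Proof.
move=> /continuousP cf.
apply: (measurability _ (RGenOpens.measurableE R)).
move=> _ [_ [a [b ->] <-]]; rewrite setTI comp_preimage.
by apply: measurable_preimage_open; apply: cf; exact: interval_open.
Qed.

End measurability.

(** * Affine changes of variables *)

Section affine1.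
Context {R : realType}.
Local Notation mu := (@lebesgue_measure R).

Let aff (a s : R) (x : measurableTypeR R) : measurableTypeR R := a + s * x.

Let measurable_aff a s : measurable_fun setT (aff a s).
Proof.
by apply: measurable_funD => //; exact: measurable_funM.
Qed.

(** The push-forward of |s| times the Lebesgue measure under x |-> a + s x gives
    half-open intervals their length, so that it is the Lebesgue measure. *)
Lemma ge0_integral_affine1 (a s : R) (f : measurableTypeR R -> \bar R) :
  s != 0 -> measurable_fun setT f -> (forall x, (0 <= f x)%E) ->
  (\int[mu]_x f x = `|s|%:E * \int[mu]_x f (a + s * x)%R)%E.
Proof.
move=> s0 mf f0.
have s1 : 0 <= `|s| by [].
pose nu := pushforward (mscale (NngNum s1) mu) (aff a s).
have nuE : forall A, measurable A -> mu A = nu A.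
  apply: lebesgue_measure_unique => _ [[u v] _ <-].
  rewrite [RHS](_ : _ = (`|s|%:E * mu (aff a s @^-1` [set` `]u, v]%R]))%E) //=.
  have [s_gt0|s_lt0|s_eq0] := ltgtP 0 s; last by rewrite -s_eq0 eqxx in s0.
  - rewrite (_ : aff a s @^-1` _ = `](u - a) / s, (v - a) / s]%classic).
      rewrite !lebesgue_measure_itv /= !lte_fin ltr_pM2r ?invr_gt0// ltrD2r.
      case: ifP => _; last by rewrite mule0.
      rewrite -!EFinD -EFinM gtr0_norm//; congr EFin.
      by field; rewrite gt_eqF.
    apply/seteqP; split => x /=; rewrite !in_itv /= /aff.
      by rewrite ltr_pdivrMr// ler_pdivlMr// => /andP[? ?]; apply/andP; split; lra.
    by rewrite ltr_pdivrMr// ler_pdivlMr// => /andP[? ?]; apply/andP; split; lra.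
  - rewrite (_ : aff a s @^-1` _ = `[(v - a) / s, (u - a) / s[%classic).
      rewrite !lebesgue_measure_itv /= !lte_fin ltr_nM2r ?invr_lt0// ltrD2r.
      case: ifP => _; last by rewrite mule0.
      rewrite -!EFinD -EFinM ltr0_norm//; congr EFin.
      by field; rewrite lt_eqF.
    apply/seteqP; split => x /=; rewrite !in_itv /= /aff.
      by rewrite ltr_ndivlMr// ler_ndivrMr// => /andP[? ?]; apply/andP; split; lra.
    by rewrite ltr_ndivlMr// ler_ndivrMr// => /andP[? ?]; apply/andP; split; lra.
rewrite (eq_measure_integral nu); last by move=> A mA _; exact: nuE.
rewrite ge0_integral_pushforward//.
rewrite preimage_setT.
rewrite ge0_integral_mscale//.
  exact: measurableT_comp.
by move=> x _; exact: f0.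
Qed.

End affine1.

Section tonelli.
Context {R : realType}.
Local Notation Rn n := (n.-tuple (measurableTypeR R)).

(** Tonelli's theorem for the splitting of the first coordinate. It is what
    allows inductions on the dimension. *)
Lemma ge0_integral_tuple_cons n (f : Rn n.+1 -> \bar R) :
  measurable_fun setT f -> (forall t, (0 <= f t)%E) ->
  (\int[lebesgue_tuple n.+1]_t f t =
   \int[lebesgue_measure]_x \int[lebesgue_tuple n]_t f (tuple_cons (x, t)))%E.
Proof.
move=> mf f0.
transitivity (\int[(lebesgue_measure \x lebesgue_tuple n)%E]_p
  f (tuple_cons p))%E.
  by rewrite ge0_integral_pushforward//; exact: measurable_tuple_cons.
rewrite fubini_tonelli1//=.
by apply: measurableT_comp => //; exact: measurable_tuple_cons.
Qed.

Definition affine_tuple n (a : n.-tuple R) (s : R) (t : Rn n) : Rn n :=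
  [tuple tnth a j + s * tnth t j | j < n].

Lemma measurable_affine_tuple n a s : measurable_fun setT (@affine_tuple n a s).
Proof.
apply/measurable_fun_tnthP => j.
rewrite (_ : _ \o _ = fun t : Rn n => tnth a j + s * tnth t j :> R); last first.
  by apply/funext => t /=; rewrite tnth_mktuple.
apply: measurable_funD => //; apply: measurable_funM => //.
exact: measurable_tnth.
Qed.

Lemma ge0_integral_affine n (a : n.-tuple R) (s : R) (f : Rn n -> \bar R) :
  s != 0 -> measurable_fun setT f -> (forall t, (0 <= f t)%E) ->
  (\int[lebesgue_tuple n]_t f t =
   (`|s| ^+ n)%:E * \int[lebesgue_tuple n]_t f (affine_tuple a s t))%E.
Proof.
move=> s0; elim: n a f => [|n IH] a f mf f0.
  by rewrite expr0 mul1e; apply: eq_integral => t _;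
    rewrite [in RHS]tuple0 [in LHS]tuple0.
have mc x : measurable_fun setT (fun t : Rn n => tuple_cons (x, t)).
  by apply: measurableT_comp; [exact: measurable_tuple_cons|].
pose F x := (\int[lebesgue_tuple n]_t f (tuple_cons (x, t)))%E.
have mF : measurable_fun setT F.
  apply: (measurable_fun_fubini_tonelli_F (f \o @tuple_cons R n)) => //=.
  by apply: measurableT_comp => //; exact: measurable_tuple_cons.
have F0 x : (0 <= F x)%E by exact: integral_ge0.
rewrite ge0_integral_tuple_cons// (@ge0_integral_affine1 R (tnth a ord0) s F)//.
rewrite ge0_integral_tuple_cons//; last first.
  exact: (measurableT_comp mf (measurable_affine_tuple a s)).
have -> : (\int[lebesgue_measure]_x F (tnth a ord0 + s * x)%R =
  \int[lebesgue_measure]_x ((`|s| ^+ n)%:E *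
   \int[lebesgue_tuple n]_t f (affine_tuple a s (tuple_cons (x, t)))))%E.
  apply: eq_integral => x _.
  rewrite /F (IH [tuple of behead a])//; last exact: measurableT_comp.
  congr (_ * _)%E; apply: eq_integral => t _; congr f.
  apply: eq_from_tnth => j.
  case: (unliftP ord0 j) => [k ->|->].
    rewrite tnthS !tnth_mktuple tnthS; congr (_ + _).
    by rewrite [in RHS](tuple_eta a) tnthS.
  by rewrite tnth_mktuple.
rewrite ge0_integralZl//.
- by rewrite muleA -EFinM exprS.
- apply: (measurable_fun_fubini_tonelli_F
    (f \o affine_tuple a s \o @tuple_cons R n)) => //=.
  apply: (measurableT_comp (measurableT_comp mf (measurable_affine_tuple a s))).
  exact: measurable_tuple_cons.
- by move=> x _; exact: integral_ge0.
Qed.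

End tonelli.

(** * Fubini's theorem for functions dominated by a product *)

(** A bound by g(x) h(y) with g and h integrable makes all sections of f
    integrable, not only almost all of them; this gives a statement about
    real-valued integrals without exceptional sets. *)
Section fubini_dominated.
Context {R : realType} d1 d2 (T1 : measurableType d1) (T2 : measurableType d2).
Variables (m1 : {sigma_finite_measure set T1 -> \bar R})
  (m2 : {sigma_finite_measure set T2 -> \bar R}).
Variables (f : T1 * T2 -> R) (g : T1 -> R) (h : T2 -> R).
Hypotheses (mf : measurable_fun setT f).
Hypotheses (ig : m1.-integrable setT (EFin \o g))
  (ih : m2.-integrable setT (EFin \o h)).
Hypothesis fgh : forall x y, `|f (x, y)| <= g x * h y.

Lemma integrable_dominated1 x : m2.-integrable setT (fun y => (f (x, y))%:E).
Proof.
have ih' := integrableZl measurableT (g x) ih.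
apply: le_integrable ih' => //.
  by apply/measurable_EFinP; exact: measurableT_comp.
by move=> y _ /=; rewrite lee_fin (le_trans (fgh x y))// ler_norm.
Qed.

Lemma integrable_dominated2 y : m1.-integrable setT (fun x => (f (x, y))%:E).
Proof.
have ig' := integrableZr measurableT (h y) ig.
apply: le_integrable ig' => //.
  by apply/measurable_EFinP; exact: measurableT_comp.
by move=> x _ /=; rewrite lee_fin (le_trans (fgh x y))// ler_norm.
Qed.

Lemma integrable_prod_dominated : (m1 \x m2)%E.-integrable setT (EFin \o f).
Proof.
apply/integrable12ltyP; first exact/measurable_EFinP.
have mh : measurable_fun setT (EFin \o h) by exact: measurable_int ih.
have mg : measurable_fun setT (EFin \o g) by exact: measurable_int ig.
have ah : m2.-integrable setT (fun y => (`|h y|)%:E) by exact: (integrable_abse ih).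
have ag : m1.-integrable setT (fun y => (`|g y|)%:E) by exact: (integrable_abse ig).
have fh : (\int[m2]_y (`|h y|)%:E)%E \is a fin_num by exact: integrable_fin_num.
apply: (@le_lt_trans _ _ (\int[m1]_x ((`|g x|)%:E * \int[m2]_y (`|h y|)%:E))%E).
  apply: ge0_le_integral => //.
  - by move=> x _; exact: integral_ge0.
  - apply: (measurable_fun_fubini_tonelli_F (abse \o (EFin \o f))) => //=.
    by apply: measurableT_comp => //; exact/measurable_EFinP.
  - apply: emeasurable_funM => //.
    by apply: measurable_int ag.
  - move=> x _.
    rewrite -ge0_integralZl//; last first.
      by apply: measurable_int ah.
    apply: ge0_le_integral => //.
    + apply: measurableT_comp => //; apply/measurable_EFinP.
      by apply: measurableT_comp.
    + by apply: emeasurable_funM => //; exact: measurable_int ah.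
    + move=> y _; rewrite -EFinM lee_fin (le_trans (fgh x y))// -normrM.
      exact: ler_norm.
rewrite -(fineK fh) ge0_integralZr//.
- rewrite lte_mul_pinfty//.
  + by apply: integral_ge0 => // x _; rewrite lee_fin.
  + exact: integrable_fin_num.
  + exact: ltry.
- by apply: measurable_int ag.
- by rewrite lee_fin fine_ge0// integral_ge0.
Qed.

Let F1 x : ((\int[m2]_y f (x, y))%R)%:E = (\int[m2]_y (f (x, y))%:E)%E.
Proof. by rewrite /Rintegral fineK//; exact/integrable_fin_num/integrable_dominated1. Qed.

Let F2 y : ((\int[m1]_x f (x, y))%R)%:E = (\int[m1]_x (f (x, y))%:E)%E.
Proof. by rewrite /Rintegral fineK//; exact/integrable_fin_num/integrable_dominated2. Qed.

Lemma integrable_fubini_dominated1 :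
  m1.-integrable setT (fun x => (\int[m2]_y f (x, y))%:E).
Proof.
under eq_fun do rewrite F1.
exact: (integrable_fubini_F integrable_prod_dominated).
Qed.

Lemma Rintegral_prod_dominated :
  \int[(m1 \x m2)%E]_z f z = \int[m1]_x \int[m2]_y f (x, y).
Proof.
rewrite /Rintegral; congr fine.
rewrite -(integral12_prod_meas1 integrable_prod_dominated).
by apply: eq_integral => x _; rewrite [RHS]F1.
Qed.

Lemma Rintegral_fubini_dominated :
  \int[m1]_x \int[m2]_y f (x, y) = \int[m2]_y \int[m1]_x f (x, y).
Proof.
rewrite /Rintegral; congr fine.
transitivity (\int[m1]_x \int[m2]_y (f (x, y))%:E)%E.
  by apply: eq_integral => x _; exact: F1.
rewrite (Fubini integrable_prod_dominated).
by apply: eq_integral => y _; rewrite -F2.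
Qed.

End fubini_dominated.

(** From nonnegative to integrable functions, for any substitution [S] that
    divides integrals by a constant. *)
Section rescaling.
Context {R : realType} d (T : measurableType d) (m : {measure set T -> \bar R}).
Variables (S : T -> T) (k : R).
Hypotheses (mS : measurable_fun setT S) (k0 : 0 < k).
Hypothesis ge0_rescale : forall f : T -> \bar R, measurable_fun setT f ->
  (forall x, 0 <= f x)%E -> (\int[m]_x f x = k%:E * \int[m]_x f (S x))%E.

Lemma integrable_rescale (f : T -> R) :
  m.-integrable setT (EFin \o f) -> m.-integrable setT (EFin \o (f \o S)).
Proof.
move=> /integrableP[/measurable_EFinP mf foo]; apply/integrableP; split.
  by apply/measurable_EFinP; exact: measurableT_comp.
have mf' : measurable_fun setT (fun x => `|(f x)%:E|)%E.
  by apply: measurableT_comp => //; exact/measurable_EFinP.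
move: foo; rewrite (ge0_rescale mf')// !ltey.
by apply: contra => /eqP ->; rewrite gt0_muley.
Qed.

Lemma Rintegral_rescale (f : T -> R) : m.-integrable setT (EFin \o f) ->
  \int[m]_x f x = k * \int[m]_x f (S x).
Proof.
move=> fi; have fSi := integrable_rescale fi.
have mf : measurable_fun setT (EFin \o f) by exact: measurable_int fi.
have kE : k = fine k%:E by [].
rewrite /Rintegral [in RHS]kE -fineM//; last exact: integrable_fin_num.
congr fine.
rewrite [in LHS]integralE ge0_rescale//; last exact: measurable_funepos.
rewrite [X in (_ - X)%E]ge0_rescale//; last exact: measurable_funeneg.
rewrite [X in _ = (_ * X)%E](integralE m setT (fun x => (f (S x))%:E)).
rewrite [RHS]muleBr//; last first.
  rewrite fin_num_adde_defr//; exact: (integrable_pos_fin_num measurableT fSi).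
by congr (_ * _ - _ * _)%E; apply: eq_integral => x _; rewrite ?funeposE ?funenegE.
Qed.

End rescaling.

(** * The Fourier pair exp(-|x|) and 2/(1 + a^2) *)

Section kernel1.
Context {R : realType}.
Local Notation mu := (@lebesgue_measure R).

(** With k >= 1 the integrand is nonnegative, so that its integral is the limit of
    a primitive at infinity, by monotone convergence. The integrals of exp(-x) and
    of exp(-x) cos(a x) are recovered from two values of k. *)
Lemma integral_halfline_exp_cos (k a : R) : 1 <= k ->
  (\int[mu]_(x in `[0%R, +oo[) (expR (- x) * (k - cos (a * x)))%:E =
   (k - (1 + a ^+ 2)^-1)%:E)%E.
Proof.
move=> k1.
have a20 : 1 + a ^+ 2 != 0 by rewrite gt_eqF// ltr_wpDr// sqr_ge0.
pose f (x : R) := expR (- x) * (k - cos (a * x)).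
pose F (x : R) := expR (- x) *
  ((cos (a * x) - a * sin (a * x)) / (1 + a ^+ 2) - k).
have dF (x : R) : is_derive x 1 F (f x).
  rewrite /F; apply: is_derive_eq.
  rewrite /f /GRing.scale /=.
  by field.
have cf : continuous f.
  move=> x; apply: differentiable_continuous; apply/derivable1_diffP.
  by apply: ex_derive.
rewrite (@ge0_continuous_FTC2y _ f F 0 0).
- rewrite -EFinB /F oppr0 expR0 mulr0 sin0 cos0; congr EFin.
  by field.
- move=> x _; rewrite mulr_ge0 ?expR_ge0// subr_ge0.
  by rewrite (le_trans _ k1)// cos_le1.
- by apply: continuous_subspaceT.
- apply: norm_cvg0; apply: (@squeeze_cvgr _ _ _ _ (cst 0)
    (fun x => expR (- x) * (1 + `|a| + k))).
  + apply: nearW => x; rewrite normr_ge0 /= normrM ger0_norm ?expR_ge0//.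
    rewrite ler_wpM2l ?expR_ge0// (le_trans (ler_normB _ _))// lerD//; last first.
      by rewrite ger0_norm// (le_trans _ k1).
    rewrite normrM normfV [`|1 + _|]ger0_norm ?addr_ge0 ?sqr_ge0//.
    rewrite ler_pdivrMr ?ltr_wpDr ?sqr_ge0// (le_trans (ler_normB _ _))//.
    rewrite -[X in X <= _]mulr1 ler_pM ?addr_ge0// ?lerDl ?sqr_ge0//.
    rewrite lerD//; first by rewrite ler_norml cos_geN1 cos_le1.
    rewrite normrM -[X in _ <= X]mulr1 ler_wpM2l//.
    by rewrite ler_norml sin_geN1 sin_le1.
  + exact: cvg_cst.
  + rewrite -[X in _ --> X](mul0r (1 + `|a| + k)).
    by apply: cvgMl; exact: cvgr_expR.
- by move=> x _; apply: ex_derive.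
- apply: cvg_at_right_filter; apply: differentiable_continuous.
  by apply/derivable1_diffP; apply: ex_derive.
- by move=> x _; rewrite derive1E; exact: derive_val.
Qed.

Lemma integral_exp_cos (k a : R) : 1 <= k ->
  (\int[mu]_x (expR (- `|x|) * (k - cos (a * x)))%:E =
   (2 * (k - (1 + a ^+ 2)^-1))%:E)%E.
Proof.
move=> k1; rewrite ge0_symfun_integralT.
- rewrite [RHS]EFinM -integral_halfline_exp_cos// set_itvcy; congr (_ * _)%E.
  by apply: eq_integral => x /[!inE] /= x0; rewrite ger0_norm.
- move=> x; rewrite mulr_ge0 ?expR_ge0// subr_ge0.
  by rewrite (le_trans _ k1)// cos_le1.
- move=> x; apply: cvgM.
    apply: (@continuous_comp _ _ _ (fun x : R => - `|x|) expR).
      by apply: cvgN; exact: norm_continuous.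
    exact: continuous_expR.
  apply: cvgB; first exact: cvg_cst.
  apply: (@continuous_comp _ _ _ (fun x : R => a * x) cos).
    by apply: cvgMr; exact: cvg_id.
  exact: continuous_cos.
- by move=> x /=; rewrite normrN mulrN cosN.
Qed.

Lemma measurable_cos : measurable_fun setT (@cos R).
Proof. by apply: measurable_realfun.continuous_measurable_fun; exact: continuous_cos. Qed.

Lemma measurable_sin : measurable_fun setT (@sin R).
Proof. by apply: measurable_realfun.continuous_measurable_fun; exact: continuous_sin. Qed.

Lemma measurable_expabs : measurable_fun setT (fun x : R => expR (- `|x|)).
Proof.
by apply: measurableT_comp => //; apply: measurableT_comp.
Qed.

(** The free phase c is what makes the n-dimensional formula go through by
    induction: the remaining coordinates act as a phase. *)
Lemma integral_expabs_cos (c a : R) :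
  [/\ mu.-integrable setT (fun x => (expR (- `|x|))%:E) &
   \int[mu]_x (expR (- `|x|) * cos (c + a * x)) = 2 * cos c / (1 + a ^+ 2)].
Proof.
have ecE k (x : R) : expR (- `|x|) * (k - cos (a * x)) =
  k * expR (- `|x|) - expR (- `|x|) * cos (a * x) by ring.
have mec : measurable_fun setT (fun x : R => expR (- `|x|) * cos (a * x)).
  apply: measurable_funM; first exact: measurable_expabs.
  by apply: (measurableT_comp measurable_cos); exact: measurable_funM.
have i1 (k : R) : 1 <= k -> mu.-integrable setT
    (fun x => (expR (- `|x|) * (k - cos (a * x)))%:E).
  move=> k1; apply/integrableP; split.
    apply/measurable_EFinP; under eq_fun do rewrite ecE.
    apply: measurable_funB => //; apply: measurable_funM => //.
    exact: measurable_expabs.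
  under eq_integral => x _.
    rewrite gee0_abs; last first.
      rewrite lee_fin mulr_ge0 ?expR_ge0// subr_ge0 (le_trans _ k1)// cos_le1//.
    over.
  by rewrite integral_exp_cos// ltry.
have i2 := i1 2 ltac:(by lra); have {i1}i1 := i1 1 (lexx 1).
have E2 := @integral_exp_cos 2 a ltac:(by lra).
have E1 := @integral_exp_cos 1 a (lexx 1).
have ie : mu.-integrable setT (fun x => (expR (- `|x|))%:E).
  rewrite (_ : (fun x : R => _) = (fun x => (expR (- `|x|) * (2 - cos (a * x)))%:E)
     \- (fun x => (expR (- `|x|) * (1 - cos (a * x)))%:E))%E.
    exact: integrableB.
  by apply/funext => x /=; rewrite -EFinB; congr EFin; ring.
split => //.
have icos : mu.-integrable setT (fun x => (expR (- `|x|) * cos (a * x))%:E).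
  apply: le_integrable ie => //; first exact/measurable_EFinP.
  move=> x _ /=; rewrite lee_fin normrM -[X in _ <= X]mulr1 ler_wpM2l//.
  by rewrite ler_norml cos_geN1 cos_le1.
have isin : mu.-integrable setT (fun x => (expR (- `|x|) * sin (a * x))%:E).
  apply: le_integrable ie => //.
    apply/measurable_EFinP; apply: measurable_funM; first exact: measurable_expabs.
    by apply: (measurableT_comp measurable_sin); exact: measurable_funM.
  move=> x _ /=; rewrite lee_fin normrM -[X in _ <= X]mulr1 ler_wpM2l//.
  by rewrite ler_norml sin_geN1 sin_le1.
(* the integrand is odd; reflect *)
have S0 : \int[mu]_x (expR (- `|x|) * sin (a * x)) = 0.
  have mS : measurable_fun setT
      (fun x : measurableTypeR R => 0 + (-1) * x : measurableTypeR R).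
    by apply: measurable_funD => //; exact: measurable_funM.
  have S (f : measurableTypeR R -> \bar R) : measurable_fun setT f ->
      (forall x, (0 <= f x)%E) ->
      (\int[mu]_x f x = 1%:E * \int[mu]_x f (0 + (-1) * x)%R)%E.
    move=> mf f0; have := @ge0_integral_affine1 R 0 (-1) f _ mf f0.
    by rewrite normrN normr1; apply; rewrite oppr_eq0 oner_eq0.
  have := Rintegral_rescale mS ltr01 S isin.
  rewrite mul1r.
  under [RHS]eq_Rintegral do rewrite add0r mulN1r normrN mulrN sinN mulrN -mulN1r.
  rewrite RintegralZl// => h; lra.
(* (2 - cos) - 2 (1 - cos) = cos *)
have C0 : \int[mu]_x (expR (- `|x|) * cos (a * x)) = 2 / (1 + a ^+ 2).
  have : \int[mu]_x (expR (- `|x|) * (2 - cos (a * x))) -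
    2 * \int[mu]_x (expR (- `|x|) * (1 - cos (a * x))) = 2 / (1 + a ^+ 2).
    by rewrite /Rintegral E1 E2 /=; ring.
  rewrite -RintegralZl// -RintegralB//; last exact: (integrableZl measurableT 2 i1).
  move=> <-; apply: eq_Rintegral => x _; ring.
transitivity (\int[mu]_x (cos c * (expR (- `|x|) * cos (a * x)) -
  sin c * (expR (- `|x|) * sin (a * x)))).
  by apply: eq_Rintegral => x _; rewrite cosD; ring.
rewrite RintegralB//; [|exact: (integrableZl measurableT _ icos)
  |exact: (integrableZl measurableT _ isin)].
by rewrite !RintegralZl// S0 C0; ring.
Qed.

Lemma integrable_oneDsqrV :
  mu.-integrable setT (fun x => ((1 + x ^+ 2)^-1)%:E).
Proof.
have c : continuous (fun x : R => (1 + x ^+ 2)^-1).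
  exact: (@continuous_oneDsqrV R).
apply/integrableP; split.
  by apply/measurable_EFinP; exact: measurable_realfun.continuous_measurable_fun.
have g0 (x : R) : 0 <= (1 + x ^+ 2)^-1 by rewrite invr_ge0 addr_ge0// sqr_ge0.
under eq_integral => x _ do rewrite gee0_abs ?lee_fin//.
rewrite ge0_symfun_integralT//; last by move=> x /=; rewrite sqrrN.
by rewrite -set_itvcy (integral0y_oneDsqr R) -EFinM ltry.
Qed.

End kernel1.

(** * Integration of real functions on R^n *)

Section integral_on_Rn.
Context {R : realType}.
Local Notation mu := (@lebesgue_measure R).

Definition measurable_Rn n (f : 'rV[R]_n -> R) :=
  measurable_fun setT (f \o @tuple_row R n).

Definition integrable_Rn n (f : 'rV[R]_n -> R) :=
  (lebesgue_tuple n).-integrable setT (EFin \o (f \o @tuple_row R n)).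

Definition int_Rn n (f : 'rV[R]_n -> R) : R :=
  \int[lebesgue_tuple n]_t f (tuple_row t).

Lemma measurable_integrable_Rn n (f : 'rV[R]_n -> R) :
  integrable_Rn f -> measurable_Rn f.
Proof. by move=> /integrableP[/measurable_EFinP]. Qed.

Lemma le_integrable_Rn n (f g : 'rV[R]_n -> R) : measurable_Rn f ->
  (forall x, `|f x| <= g x) -> integrable_Rn g -> integrable_Rn f.
Proof.
move=> mf fg; apply: le_integrable => //; first exact/measurable_EFinP.
by move=> t _ /=; rewrite lee_fin (le_trans (fg _))// ler_norm.
Qed.

Lemma integrable_RnZ n (k : R) (f : 'rV[R]_n -> R) :
  integrable_Rn f -> integrable_Rn (fun x => k * f x).
Proof. exact: integrableZl. Qed.

Lemma integrable_RnD n (f g : 'rV[R]_n -> R) :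
  integrable_Rn f -> integrable_Rn g -> integrable_Rn (fun x => f x + g x).
Proof. exact: integrableD. Qed.

Lemma int_RnZ n (k : R) (f : 'rV[R]_n -> R) :
  integrable_Rn f -> int_Rn (fun x => k * f x) = k * int_Rn f.
Proof. exact: RintegralZl. Qed.

Lemma int_RnD n (f g : 'rV[R]_n -> R) : integrable_Rn f -> integrable_Rn g ->
  int_Rn (fun x => f x + g x) = int_Rn f + int_Rn g.
Proof. exact: RintegralD. Qed.

Lemma eq_int_Rn n (f g : 'rV[R]_n -> R) : f =1 g -> int_Rn f = int_Rn g.
Proof. by move=> fg; apply: eq_Rintegral => t _; exact: fg. Qed.

Lemma le_norm_int_Rn n (f g : 'rV[R]_n -> R) : measurable_Rn f ->
  (forall x, `|f x| <= g x) -> integrable_Rn g -> `|int_Rn f| <= int_Rn g.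
Proof.
move=> mf fg ig; have fi := le_integrable_Rn mf fg ig.
rewrite (le_trans (le_normr_Rintegral measurableT fi))//.
apply: le_Rintegral => //; first exact: (integrable_abse fi).
by move=> t _; exact: fg.
Qed.

Lemma dominated_cvg_int_Rn n (f_ : nat -> 'rV[R]_n -> R) (f g : 'rV[R]_n -> R) :
  (forall m, measurable_Rn (f_ m)) ->
  (forall x, f_ ^~ x @ \oo --> f x) -> integrable_Rn g ->
  (forall m x, `|f_ m x| <= g x) ->
  int_Rn (f_ m) @[m --> \oo] --> int_Rn f.
Proof.
move=> mf f_f ig f_g; rewrite /int_Rn /Rintegral; apply: fine_cvg.
have fe (x : 'rV[R]_n) : EFin (f_ m x) @[m --> \oo] --> (f x)%:E.
  by apply: cvg_EFin; [exact: nearW|exact: f_f].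
have mfl : measurable_Rn f.
  apply/measurable_EFinP.
  apply: (@emeasurable_fun_cvg _ _ _ _ (fun m t => (f_ m (tuple_row t))%:E)) => //.
  by move=> m; apply/measurable_EFinP; exact: mf.
have fg x : `|f x| <= g x.
  have h : `|f_ m x| @[m --> \oo] --> `|f x|.
    by apply: cvg_norm; exact: f_f.
  rewrite -(cvg_lim _ h)//; apply: limr_le; first by apply/cvg_ex; exists `|f x|.
  by apply: nearW => m; exact: f_g.
rewrite fineK; last first.
  by apply: integrable_fin_num => //; exact: le_integrable_Rn mfl fg ig.
apply: (@dominated_cvg _ _ _ _ _ _ _ _ (fun t => (g (tuple_row t))%:E)) => //.
- by move=> m; apply/measurable_EFinP; exact: mf.
- by move=> m t _ /=; rewrite lee_fin.
Qed.

Section affine.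
Variables (n : nat) (a : 'rV[R]_n) (s : R) (s0 : s != 0).

Let ta : n.-tuple R := [tuple a ord0 j | j < n].

Let rowE (t : n.-tuple (measurableTypeR R)) :
  tuple_row (affine_tuple ta s t) = a + s *: tuple_row t.
Proof. by apply/rowP => j; rewrite !mxE !tnth_mktuple. Qed.

Let sn : 0 < `|s| ^+ n. Proof. by rewrite exprn_gt0// normr_gt0. Qed.

Lemma measurable_affine_Rn (f : 'rV[R]_n -> R) :
  measurable_Rn f -> measurable_Rn (fun x => f (a + s *: x)).
Proof.
move=> mf.
have := measurableT_comp mf (measurable_affine_tuple ta s).
by congr measurable_fun; apply/funext => t /=; rewrite rowE.
Qed.

Lemma integrable_affine_Rn (f : 'rV[R]_n -> R) :
  integrable_Rn f -> integrable_Rn (fun x => f (a + s *: x)).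
Proof.
move=> fi; have := integrable_rescale (measurable_affine_tuple ta s) sn
  (fun f mf f0 => ge0_integral_affine ta s0 mf f0) fi.
by congr integrable; apply/funext => t /=; rewrite rowE.
Qed.

Lemma int_affine_Rn (f : 'rV[R]_n -> R) : integrable_Rn f ->
  int_Rn f = `|s| ^+ n * int_Rn (fun x => f (a + s *: x)).
Proof.
move=> fi; have := Rintegral_rescale (measurable_affine_tuple ta s) sn
  (fun f mf f0 => ge0_integral_affine ta s0 mf f0) fi.
rewrite /int_Rn => ->; congr (_ * _).
by apply: eq_Rintegral => t _ /=; rewrite rowE.
Qed.

End affine.

Section fubini.
Variables (n m : nat) (F : 'rV[R]_n -> 'rV[R]_m -> R).
Variables (g : 'rV[R]_n -> R) (h : 'rV[R]_m -> R).
Hypothesis mF : measurable_fun setT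
  (fun p : n.-tuple (measurableTypeR R) * m.-tuple (measurableTypeR R) =>
     F (tuple_row p.1) (tuple_row p.2)).
Hypotheses (ig : integrable_Rn g) (ih : integrable_Rn h).
Hypothesis Fgh : forall x y, `|F x y| <= g x * h y.

Lemma fubini_Rn : int_Rn (fun x => int_Rn (F x)) =
  int_Rn (fun y => int_Rn (F ^~ y)).
Proof.
exact: (Rintegral_fubini_dominated mF ig ih (fun t u => Fgh _ _)).
Qed.

Lemma integrable_fubini_Rn : integrable_Rn (fun x => int_Rn (F x)).
Proof.
exact: (integrable_fubini_dominated1 mF ig ih (fun t u => Fgh _ _)).
Qed.

End fubini.

Definition tensor (n : nat) (g : R -> R) (x : 'rV[R]_n) := \prod_(j < n) g (x ord0 j).

Arguments tensor n g x : clear implicits.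

Section tensor.
Variable g : R -> R.
Hypotheses (g0 : forall x, 0 <= g x)
  (ig : mu.-integrable setT (fun x : measurableTypeR R => (g x)%:E)).

Let mg : measurable_fun setT (g : measurableTypeR R -> R).
Proof. by apply/measurable_EFinP; exact: measurable_int ig. Qed.

Lemma tensor_ge0 n x : 0 <= tensor n g x.
Proof. exact: prodr_ge0. Qed.

Lemma tensor_cons n (x : R) (t : n.-tuple R) :
  tensor n.+1 g (tuple_row (tuple_cons (x, t))) = g x * tensor n g (tuple_row t).
Proof.
rewrite /tensor big_ord_recl; congr (g _ * _); first by rewrite mxE.
by apply: eq_bigr => j _; rewrite !mxE tnthS.
Qed.

Lemma measurable_tensor n : measurable_Rn (tensor n g).
Proof.
rewrite /measurable_Rn /tensor; apply: measurable_prod => j _.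
rewrite (_ : (fun _ => _) = g \o (fun t : n.-tuple (measurableTypeR R) => tnth t j)).
  by apply: measurableT_comp => //; exact: measurable_tnth.
by apply/funext => t /=; rewrite mxE.
Qed.

Lemma integrable_tensor n : integrable_Rn (tensor n g).
Proof.
elim: n => [|n IH].
  apply/integrableP; split.
    by apply/measurable_EFinP; exact: measurable_tensor.
  rewrite integral_dirac//; first by rewrite diracE in_setT mul1e ltry.
  by apply: measurableT_comp => //; apply/measurable_EFinP; exact: measurable_tensor.
apply: (integrable_pushforward (@measurable_tuple_cons R n)) => //.
  apply/measurable_EFinP; exact: measurable_tensor.
have -> : (EFin \o (tensor n.+1 g \o @tuple_row R n.+1)) \o @tuple_cons R n =
    EFin \o (fun p => g p.1 * tensor n g (tuple_row p.2)).
  by apply/funext => -[x t] /=; rewrite tensor_cons.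
apply: (integrable_prod_dominated _ ig IH) => [|x t].
  apply: measurable_funM; first exact: measurableT_comp.
  exact: (measurableT_comp (@measurable_tensor n)).
by rewrite /= ger0_norm// mulr_ge0// tensor_ge0.
Qed.

Lemma measurable_cos_lin n (z : 'I_n -> R) (c : R) :
  measurable_Rn (fun x : 'rV[R]_n => cos (c + \sum_(j < n) z j * x ord0 j)).
Proof.
apply: (measurableT_comp measurable_cos); apply: measurable_funD => //=.
apply: measurable_sum => j; apply: measurable_funM => //.
rewrite (_ : (fun _ => _) = (fun t : n.-tuple (measurableTypeR R) => tnth t j)).
  exact: measurable_tnth.
by apply/funext => t /=; rewrite mxE.
Qed.

Lemma integrable_tensor_cos n (z : 'I_n -> R) (c : R) :
  integrable_Rn (fun x => tensor n g x * cos (c + \sum_(j < n) z j * x ord0 j)).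
Proof.
apply: (le_integrable_Rn _ _ (@integrable_tensor n)).
  by apply: measurable_funM; [exact: measurable_tensor|exact: measurable_cos_lin].
move=> x; rewrite normrM ger0_norm ?tensor_ge0// -[X in _ <= X]mulr1.
by rewrite ler_wpM2l ?tensor_ge0// ler_norml cos_geN1 cos_le1.
Qed.

(** If w is the transform of g, then the n-fold tensor power of w is the transform
    of that of g. The induction splits off the first coordinate x and absorbs
    z_0 x into the phase. *)
Lemma int_tensor_cos n (w : R -> R) (z : 'I_n -> R) (c : R) :
  (forall c a, \int[mu]_x (g x * cos (c + a * x)) = cos c * w a) ->
  int_Rn (fun x => tensor n g x * cos (c + \sum_(j < n) z j * x ord0 j)) =
  cos c * \prod_(j < n) w (z j).
Proof.
move=> gw; elim: n z c => [|n IH] z c.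
  rewrite /int_Rn /Rintegral integral_dirac//; last first.
    apply/measurable_EFinP; exact: (measurable_integrable_Rn (integrable_tensor_cos _ _)).
  by rewrite diracE in_setT mul1e /= /tensor !big_ord0 addr0 mul1r mulr1.
pose f (x : 'rV[R]_n.+1) := tensor n.+1 g x * cos (c + \sum_(j < n.+1) z j * x ord0 j).
pose z' j := z (lift ord0 j).
have fE x t : f (tuple_row (tuple_cons (x, t))) =
    (g x * tensor n g (tuple_row t)) *
    cos ((c + z ord0 * x) + \sum_(j < n) z' j * (tuple_row t) ord0 j).
  rewrite /f tensor_cons big_ord_recl addrA mxE; congr (_ * cos (_ + _)).
  by apply: eq_bigr => j _; rewrite !mxE tnthS.
have mf : measurable_Rn f.
  exact: (measurable_integrable_Rn (integrable_tensor_cos _ _)).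
pose f2 (p : measurableTypeR R * n.-tuple (measurableTypeR R)) :=
   f (tuple_row (tuple_cons p)).
have mf2 : measurable_fun setT f2.
  exact: (measurableT_comp mf (@measurable_tuple_cons R n)).
have f2le x t : `|f2 (x, t)| <= g x * tensor n g (tuple_row t).
  rewrite /f2 fE normrM ger0_norm ?mulr_ge0 ?tensor_ge0//.
  rewrite -[X in _ <= X]mulr1 ler_wpM2l ?mulr_ge0 ?tensor_ge0//.
  by rewrite ler_norml cos_geN1 cos_le1.
transitivity (\int[(mu \x lebesgue_tuple n)%E]_p f2 p).
  rewrite /int_Rn /Rintegral; congr fine.
  rewrite (integral_pushforward (@measurable_tuple_cons R n))//.
  + exact/measurable_EFinP.
  + exact: (integrable_prod_dominated mf2 ig (integrable_tensor n) f2le).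
rewrite (Rintegral_prod_dominated mf2 ig (integrable_tensor n) f2le).
transitivity (\int[mu]_x ((\prod_(j < n) w (z' j)) * (g x * cos (c + z ord0 * x)))).
  apply: eq_Rintegral => x _.
  rewrite mulrCA [X in g x * X]mulrC -IH -int_RnZ; last first.
    exact: integrable_tensor_cos.
  by apply: eq_Rintegral => t _; rewrite /f2 fE mulrA.
rewrite RintegralZl//; last first.
  have mgc : measurable_fun setT
      (fun x : measurableTypeR R => g x * cos (c + z ord0 * x)).
    apply: measurable_funM => //; apply: (measurableT_comp measurable_cos).
    by apply: measurable_funD => //; exact: measurable_funM.
  apply: le_integrable ig => //; first exact/measurable_EFinP.
  move=> x _; rewrite lee_fin normrM -[X in _ <= X]mulr1 ler_wpM2l//.
  by rewrite ler_norml cos_geN1 cos_le1.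
by rewrite gw big_ord_recl mulrCA [X in _ * X]mulrC mulrA.
Qed.

End tensor.

End integral_on_Rn.

Arguments tensor {R} n g x.

(** * Directional derivatives and plane waves *)

Section lines.
Context {R : realType} (n : nat).
Local Notation Rn := 'rV[R]_n.

Lemma is_derive_line (g : Rn -> R) (x v : Rn) (t : R) :
  derivable g (x + t *: v) v ->
  is_derive t 1 (fun t => g (x + t *: v)) ('D_v g (x + t *: v)).
Proof.
move=> dg.
have E : (fun h : R => h^-1 *: ((g \o shift (x + t *: v)) (h *: v) - g (x + t *: v)))
  = (fun h : R => h^-1 *: (((fun t => g (x + t *: v)) \o shift t) (h *: 1) -
     g (x + t *: v))).
  apply/funext => h /=; congr (_ *: (g _ - _)).
  by rewrite scaler1 scalerDl addrCA.
apply: DeriveDef; first by move: dg; rewrite /derivable E.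
by rewrite /derive E.
Qed.

Lemma derive_line (g : Rn -> R) (x v : Rn) :
  'D_v g x = derive1 (fun t : R => g (x + t *: v)) 0.
Proof.
rewrite /derive1 /derive.
have -> // : (fun h : R => h^-1 *: ((g \o shift x) (h *: v) - g x)) =
  (fun h : R => h^-1 *: (g (x + (h + 0) *: v) - g (x + 0 *: v))).
by apply/funext => h /=; rewrite addr0 scale0r addr0 [x + _]addrC.
Qed.

Lemma derivable_line (g : Rn -> R) (x v : Rn) :
  derivable (fun t : R => g (x + t *: v)) 0 1 -> derivable g x v.
Proof.
rewrite /derivable.
have -> // : (fun h : R => h^-1 *: ((g \o shift x) (h *: v) - g x)) =
  (fun h : R => h^-1 *: (((fun t : R => g (x + t *: v)) \o shift 0) (h *: 1) -
    g (x + 0 *: v))).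
by apply/funext => h /=; rewrite addr0 scale0r addr0 scaler1 [x + _]addrC.
Qed.

End lines.

Section wave.
Context {R : realType} (n : nat).
Local Notation Rn := 'rV[R]_n.
Local Notation e j := (delta_mx ord0 j : Rn).

(** The phase c makes the family closed under differentiation: c = 0 is the
    cosine and c = - pi/2 the sine. *)
Definition wave (c : R) (x xi : Rn) : R := cos (c + 2 * pi * dot x xi).

Lemma dotC (x y : Rn) : dot x y = dot y x.
Proof. by apply: eq_bigr => j _; rewrite mulrC. Qed.

Lemma dotDl (x y z : Rn) : dot (x + y) z = dot x z + dot y z.
Proof. by rewrite -big_split; apply: eq_bigr => j _; rewrite mxE mulrDl. Qed.

Lemma dotZl a (x y : Rn) : dot (a *: x) y = a * dot x y.
Proof. by rewrite mulr_sumr; apply: eq_bigr => j _; rewrite mxE mulrA. Qed.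

Lemma dot_delta j (x : Rn) : dot (e j) x = x ord0 j.
Proof.
rewrite /dot (bigD1 j)//= mxE !eqxx mul1r big1 ?addr0// => i ij.
by rewrite mxE eqxx (negbTE ij) mul0r.
Qed.

Lemma norm_wave_le1 c x xi : `|wave c x xi| <= 1.
Proof. by rewrite ler_norml cos_geN1 cos_le1. Qed.

Lemma measurable_wave c x : measurable_Rn (wave c x).
Proof.
have := measurable_cos_lin (fun j => 2 * pi * x ord0 j) c.
congr measurable_Rn; apply/funext => xi; rewrite /wave /dot mulr_sumr.
by congr (cos (_ + _)); apply: eq_bigr => j _; rewrite mulrA.
Qed.

Lemma continuous_wave c xi : continuous (wave c ^~ xi).
Proof.
move=> x.
apply: (@continuous_comp _ _ _ (fun y : Rn => c + 2 * pi * dot y xi) cos);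
  last exact: continuous_cos.
have h : continuous (fun y : Rn => dot y xi).
  rewrite /dot; apply: continuous_big => [|j _ y].
    by move=> z; apply: cvgD; [exact: cvg_fst|exact: cvg_snd].
  exact: (cvgM (@coord_continuous R 1 n ord0 j y) (cvg_cst _)).
exact: (cvgD (cvg_cst c) (cvgM (cvg_cst _) (h x))).
Qed.

Lemma is_derive_wave_line c (x xi : Rn) j (t : R) :
  is_derive t 1 (fun t => wave c (x + t *: e j) xi)
    (2 * pi * xi ord0 j * wave (c + pi / 2) (x + t *: e j) xi).
Proof.
rewrite /wave.
have E : (fun t => cos (c + 2 * pi * dot (x + t *: e j) xi)) =
  (fun t => cos ((c + 2 * pi * dot x xi) + (2 * pi * xi ord0 j) * t)).
  by apply/funext => u; rewrite dotDl dotZl dot_delta; congr cos; ring.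
rewrite E; apply: is_derive_eq.
rewrite dotDl dotZl dot_delta -cosDpihalf /GRing.scale /=.
have -> : c + pi / 2 + 2 * pi * (dot x xi + t * xi ord0 j) =
  c + 2 * pi * dot x xi + 2 * pi * xi ord0 j * t + pi / 2 by ring.
by ring.
Qed.

Lemma derive_wave c (x xi : Rn) j :
  'D_(e j) (wave c ^~ xi) x = 2 * pi * xi ord0 j * wave (c + pi / 2) x xi.
Proof.
rewrite derive_line derive1E.
have D := is_derive_wave_line c x xi j 0.
by rewrite derive_val scale0r addr0.
Qed.

Lemma derivable_wave c (x xi : Rn) j : derivable (wave c ^~ xi) x (e j).
Proof. by apply: derivable_line; have := is_derive_wave_line c x xi j 0 => -[]. Qed.

End wave.

(** * The Fourier transform of partial derivatives *)

Section decay.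
Context {R : realType} (n : nat).
Local Notation Rn := 'rV[R]_n.
Local Notation e j := (delta_mx ord0 j : Rn).
Local Notation mu := (lebesgue_tuple n).

(** The common integrable majorant of all integrands on R^n. *)
Definition decay (x : Rn) : R := tensor n (fun t => (1 + t ^+ 2)^-1) x.

Lemma oneDsqrV_ge0 (t : R) : 0 <= (1 + t ^+ 2)^-1.
Proof. by rewrite invr_ge0 addr_ge0 ?sqr_ge0. Qed.

Lemma decay_ge0 x : 0 <= decay x.
Proof. by apply: tensor_ge0 => t; exact: oneDsqrV_ge0. Qed.

Lemma integrable_decay : integrable_Rn decay.
Proof. by apply: integrable_tensor; [exact: oneDsqrV_ge0|exact: integrable_oneDsqrV]. Qed.

(** The majorant is stable under shifts of bounded length, which gives the
    domination needed to differentiate integrals of translates. *)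
Lemma decay_shift (x : Rn) j (t : R) : `|t| <= 1 ->
  decay (x + t *: e j) <= 3 * decay x.
Proof.
move=> t1; rewrite /decay /tensor (bigD1 j)//= [X in _ <= _ * X](bigD1 j)//= mulrA.
have -> : \prod_(i < n | i != j) (1 + (x + t *: e j) ord0 i ^+ 2)^-1 =
    \prod_(i < n | i != j) (1 + (x ord0 i) ^+ 2)^-1.
  by apply: eq_bigr => i ij; rewrite !mxE eqxx (negbTE ij) mulr0 addr0.
rewrite ler_wpM2r ?prodr_ge0// => [i _|]; first exact: oneDsqrV_ge0.
rewrite !mxE !eqxx mulr1.
have p (y : R) : 0 < 1 + y ^+ 2 by rewrite ltr_wpDr ?sqr_ge0.
rewrite ler_pdivlMr ?p// mulrC ler_pdivrMr ?p//.
set y := x ord0 j; have t2 : t ^+ 2 <= 1.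
  by rewrite -real_normK ?num_real// expr_le1.
(* 1 + y^2 <= 3 (1 + (y + t)^2): complete the square in y *)
have := sqr_ge0 (2 * y + 3 * t). nra.
Qed.

(** By translation invariance the integral of the translates x |-> g (x + t e_j)
    does not depend on t; differentiate in t under the integral sign at t = 0. *)
Lemma int_partial0 (g : Rn -> R) (j : 'I_n) (B : R) : 0 <= B -> continuous g ->
  (forall x, derivable g x (e j)) ->
  (forall x, `|g x| <= B * decay x) -> (forall x, `|partial j g x| <= B * decay x) ->
  int_Rn (partial j g) = 0.
Proof.
move=> B0 cg dg gB dgB.
have ig : integrable_Rn g.
  apply: le_integrable_Rn gB _; first exact: continuous_measurable_tuple.
  exact/integrable_RnZ/integrable_decay.
pose f (t : R) (y : n.-tuple (measurableTypeR R)) := g (tuple_row y + t *: e j).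
have fE t : f t = (fun x => g (t *: e j + 1 *: x)) \o @tuple_row R n.
  by apply/funext => y; rewrite /f /= scale1r addrC.
have df t y : derive1 (f^~ y) t = 'D_(e j) g (tuple_row y + t *: e j).
  rewrite derive1E; have D := is_derive_line (dg (tuple_row y + t *: e j)).
  by rewrite derive_val.
have := @differentiation_under_integral R _ _ mu f setT measurableT 0 (-1) 1 _ _ _
  (fun y => B * (3 * decay (tuple_row y))) _ _ _.
rewrite /= in_itv /= ltrN10 ltr01 => /(_ isT) H.
transitivity (derive1 (fun t => \int[mu]_(y in setT) f t y) 0); last first.
  have -> : (fun t => \int[mu]_(y in setT) f t y) = cst (int_Rn g).
    apply/funext => t; rewrite fE.
    by rewrite (int_affine_Rn (t *: e j) (oner_neq0 R) ig) normr1 expr1n mul1r.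
  by rewrite derive1_cst.
rewrite H.
- apply: eq_Rintegral => y _; rewrite /partial1of2 df scale0r addr0//.
- move=> t _; rewrite fE; exact: (integrable_affine_Rn (t *: e j) (oner_neq0 R) ig).
- by move=> t y _ _; have [] := is_derive_line (dg (tuple_row y + t *: e j)).
- by move=> y; rewrite !mulr_ge0 ?decay_ge0.
- exact: (integrable_RnZ B (integrable_RnZ 3 integrable_decay)).
- move=> t y; rewrite in_itv /= => /andP[t1 t2] _; rewrite /partial1of2 df.
  rewrite (le_trans (dgB _))// ler_wpM2l//.
  by rewrite decay_shift// ler_norml !ltW.
Qed.

Lemma continuous_oppr (f : Rn -> R) : continuous f -> continuous (fun x => - f x).
Proof. by move=> cf x; exact: (cvgN (cf x)). Qed.

Lemma continuousM_wave (f : Rn -> R) c xi :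
  continuous f -> continuous (fun x => f x * wave c x xi).
Proof. by move=> cf x; exact: (cvgM (cf x) (@continuous_wave R n c xi x)). Qed.

(** Integration by parts: [int_partial0] for the product of f and a wave. *)
Lemma int_partial_wave (f : Rn -> R) (j : 'I_n) (B c : R) (xi : Rn) : 0 <= B ->
  continuous f -> continuous (partial j f) -> (forall x, derivable f x (e j)) ->
  (forall x, `|f x| <= B * decay x) -> (forall x, `|partial j f x| <= B * decay x) ->
  int_Rn (fun x => partial j f x * wave c x xi) =
  - (2 * pi * xi ord0 j) * int_Rn (fun x => f x * wave (c + pi / 2) x xi).
Proof.
move=> B0 cf cdf df fB dfB.
have ifw (h : Rn -> R) c' : continuous h -> (forall x, `|h x| <= B * decay x) ->
    integrable_Rn (fun x => h x * wave c' x xi).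
  move=> ch hB; apply: (le_integrable_Rn _ _ (integrable_RnZ B integrable_decay)).
    by apply: continuous_measurable_tuple; exact: continuousM_wave.
  move=> x; rewrite normrM (le_trans _ (hB x))// -[X in _ <= X]mulr1.
  by rewrite ler_wpM2l// norm_wave_le1.
have dg x : partial j (fun x => f x * wave c x xi) x =
    partial j f x * wave c x xi +
    (2 * pi * xi ord0 j) * (f x * wave (c + pi / 2) x xi).
  rewrite /partial deriveM//; last exact: derivable_wave.
  by rewrite derive_wave /GRing.scale /=; ring.
have gB x : `|f x * wave c x xi| <= B * (1 + `|2 * pi * xi ord0 j|) * decay x.
  rewrite normrM -[X in _ <= X]mulr1 ler_pM ?norm_wave_le1//.
  rewrite (le_trans (fB x))// ler_wpM2r ?decay_ge0//.
  by rewrite ler_peMr// lerDl.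
have dgB x : `|partial j (fun x => f x * wave c x xi) x| <=
    B * (1 + `|2 * pi * xi ord0 j|) * decay x.
  rewrite [X in _ <= X](_ : _ = B * decay x + `|2 * pi * xi ord0 j| * (B * decay x));
    last by ring.
  rewrite dg (le_trans (ler_normD _ _))// lerD//.
    by rewrite normrM -[X in _ <= X]mulr1 ler_pM ?norm_wave_le1.
  rewrite normrM ler_wpM2l// normrM -[X in _ <= X]mulr1 ler_pM ?norm_wave_le1//.
have B1 : 0 <= B * (1 + `|2 * pi * xi ord0 j|) by rewrite mulr_ge0// addr_ge0.
have := int_partial0 B1 _ _ gB dgB.
have cg : continuous (fun x => f x * wave c x xi).
  exact: continuousM_wave.
have dgx x : derivable (fun x => f x * wave c x xi) x (e j).
  by apply: derivableM => //; exact: derivable_wave.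
move=> /(_ cg dgx).
rewrite (eq_int_Rn dg) int_RnD; [|exact: ifw|exact: integrable_RnZ (ifw _ _ cf fB)].
rewrite int_RnZ; last exact: ifw.
by move=> /eqP; rewrite addr_eq0 mulNr => /eqP.
Qed.

(** The hypothesis is on the suffixes [drop k s], because these are the
    intermediate derivatives in the order fixed by [foldr]. *)
Lemma int_partials_wave (f : Rn -> R) (s : seq 'I_n) (c : R) (xi : Rn) :
  smooth_real f ->
  (forall k, exists2 B, 0 <= B &
     forall x, `|foldr (@partial R n) f (drop k s) x| <= B * decay x) ->
  int_Rn (fun x => foldr (@partial R n) f s x * wave c x xi) =
  (\prod_(j <- s) - (2 * pi * xi ord0 j)) *
  int_Rn (fun x => f x * wave (c + (size s)%:R * (pi / 2)) x xi).
Proof.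
move=> sf; elim: s c => [|j s IH] c sB.
  by rewrite big_nil mul1r mul0r addr0.
have [B1 B10 h1] := sB 0%N; have [B2 B20 h2] := sB 1%N.
have [cg dg] := sf s; have [cdg _] := sf (j :: s).
rewrite /= (@int_partial_wave (foldr (@partial R n) f s) j (Num.max B1 B2))//.
- rewrite IH; last by move=> k; exact: (sB k.+1).
  rewrite big_cons mulrA; congr (_ * int_Rn _); apply/funext => x.
  by congr (_ * wave _ _ _); rewrite -natr1; ring.
- by rewrite le_max B10.
- move=> x; have := h2 x; rewrite /= drop0 => /le_trans; apply.
  rewrite ler_wpM2r ?decay_ge0//.
  by rewrite le_max lexx orbT.
- move=> x; have := h1 x; rewrite /= => /le_trans; apply.
  rewrite ler_wpM2r ?decay_ge0//.
  by rewrite le_max lexx.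
Qed.

(** Superpositions of waves with two amplitudes [H1] and [H2], which will be the
    real and the imaginary part of a Fourier transform. *)
Section superposition.
Variables (H1 H2 : Rn -> R).

Let amp (s : seq 'I_n) (eta : Rn) := \prod_(j <- s) (2 * pi * eta ord0 j).

Let F s c1 c2 x := int_Rn (fun eta =>
  amp s eta * (H1 eta * wave c1 x eta + H2 eta * wave c2 x eta)).

Hypothesis iH : forall s, integrable_Rn (fun eta => amp s eta * H1 eta) /\
  integrable_Rn (fun eta => amp s eta * H2 eta).

Let iHabs s : integrable_Rn (fun eta => `|amp s eta * H1 eta| + `|amp s eta * H2 eta|).
Proof.
have [i1 i2] := iH s.
by apply: integrable_RnD; [exact: (integrable_abse i1)|exact: (integrable_abse i2)].
Qed.

Let iHw s c1 c2 x : integrable_Rn (fun eta =>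
  amp s eta * (H1 eta * wave c1 x eta + H2 eta * wave c2 x eta)).
Proof.
have [i1 i2] := iH s.
apply: (le_integrable_Rn (g := fun eta => `|amp s eta * H1 eta| + `|amp s eta * H2 eta|)).
- rewrite (_ : (fun _ => _) = (fun eta => (amp s eta * H1 eta) * wave c1 x eta +
    (amp s eta * H2 eta) * wave c2 x eta)); last by apply/funext => eta; ring.
  apply: measurable_funD; apply: measurable_funM.
  + exact: measurable_integrable_Rn i1.
  + exact: measurable_wave.
  + exact: measurable_integrable_Rn i2.
  + exact: measurable_wave.
- move=> eta; rewrite mulrDr (le_trans (ler_normD _ _))// lerD//.
    by rewrite mulrA normrM -[X in _ <= X]mulr1 ler_wpM2l ?norm_wave_le1.
  by rewrite mulrA normrM -[X in _ <= X]mulr1 ler_wpM2l ?norm_wave_le1.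
- exact: iHabs.
Qed.

Lemma partial_superposition j s c1 c2 :
  partial j (F s c1 c2) = F (j :: s) (c1 + pi / 2) (c2 + pi / 2).
Proof.
apply/funext => x; rewrite /partial derive_line.
pose f (t : R) (y : n.-tuple (measurableTypeR R)) :=
  amp s (tuple_row y) * (H1 (tuple_row y) * wave c1 (x + t *: e j) (tuple_row y) +
     H2 (tuple_row y) * wave c2 (x + t *: e j) (tuple_row y)).
have df (t : R) (y : n.-tuple (measurableTypeR R)) : is_derive t 1 (f^~ y)
    (amp (j :: s) (tuple_row y) *
    (H1 (tuple_row y) * wave (c1 + pi / 2) (x + t *: e j) (tuple_row y) +
     H2 (tuple_row y) * wave (c2 + pi / 2) (x + t *: e j) (tuple_row y))).
  have D1 := is_derive_wave_line c1 x (tuple_row y) j t.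
  have D2 := is_derive_wave_line c2 x (tuple_row y) j t.
  rewrite /f; apply: is_derive_eq; rewrite /GRing.scale /= /amp big_cons.
  by ring.
rewrite (@differentiation_under_integral R _ _ mu f setT measurableT 0 (-1) 1 _ _ _
  (fun y => `|amp (j :: s) (tuple_row y) * H1 (tuple_row y)| +
    `|amp (j :: s) (tuple_row y) * H2 (tuple_row y)|) _ _ _)//.
- apply: eq_Rintegral => y _; rewrite /partial1of2 derive1E.
  by have D := df 0 y; rewrite derive_val scale0r addr0.
- by rewrite /= in_itv /= ltrN10 ltr01.
- by move=> t _; exact: iHw.
- exact: iHabs.
- move=> t y _ _; rewrite /partial1of2 derive1E; have D := df t y; rewrite derive_val.
  rewrite mulrDr (le_trans (ler_normD _ _))// lerD//.
    by rewrite mulrA normrM -[X in _ <= X]mulr1 ler_wpM2l ?norm_wave_le1.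
  by rewrite mulrA normrM -[X in _ <= X]mulr1 ler_wpM2l ?norm_wave_le1.
Qed.

Lemma partials_superposition s c1 c2 :
  foldr (@partial R n) (F [::] c1 c2) s =
  F s (c1 + (size s)%:R * (pi / 2)) (c2 + (size s)%:R * (pi / 2)).
Proof.
elim: s => [|j s IH] /=; first by rewrite mul0r !addr0.
rewrite IH partial_superposition -natr1; congr (F _ _ _); ring.
Qed.

Lemma le_partials_superposition s c1 c2 x :
  `|foldr (@partial R n) (F [::] c1 c2) s x| <=
  int_Rn (fun eta => `|amp s eta * H1 eta| + `|amp s eta * H2 eta|).
Proof.
rewrite partials_superposition; apply: le_norm_int_Rn.
- exact: measurable_integrable_Rn (iHw _ _ _ _).
- move=> eta; rewrite mulrDr (le_trans (ler_normD _ _))// lerD//.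
    by rewrite mulrA normrM -[X in _ <= X]mulr1 ler_wpM2l ?norm_wave_le1.
  by rewrite mulrA normrM -[X in _ <= X]mulr1 ler_wpM2l ?norm_wave_le1.
- exact: iHabs.
Qed.

End superposition.

End decay.

(** * Fourier inversion *)

Section inversion.
Context {R : realType} (n : nat).
Local Notation Rn := 'rV[R]_n.
Local Notation mu := (@lebesgue_tuple R n).

(** The real part of the Fourier transform of u + i v. The imaginary part is
    that of v - i u, hence [fourier_re v (- u)]. *)
Definition fourier_re (u v : Rn -> R) (xi : Rn) : R :=
  int_Rn (fun x => u x * wave 0 x xi + v x * wave (- (pi / 2)) x xi).

Definition abel_kernel (x : Rn) : R := tensor n (fun t => expR (- `|t|)) x.

Definition cauchy_kernel (x : Rn) : R := tensor n (fun t => 2 / (1 + t ^+ 2)) x.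

Let ie : (@lebesgue_measure R).-integrable setT (fun x => (expR (- `|x|))%:E).
Proof. by have [] := integral_expabs_cos (0 : R) 0. Qed.

Let e0 (x : R) : 0 <= expR (- `|x|). Proof. exact: expR_ge0. Qed.

Lemma abelE x : abel_kernel x = expR (- \sum_(j < n) `|x ord0 j|).
Proof. by rewrite -sumrN expR_sum. Qed.

Lemma abel_gt0 x : 0 < abel_kernel x.
Proof. by rewrite abelE expR_gt0. Qed.

Lemma abel_le1 x : abel_kernel x <= 1.
Proof. by rewrite abelE -expR0 ler_expR oppr_le0 sumr_ge0. Qed.

Lemma integrable_abel : integrable_Rn abel_kernel.
Proof. exact: integrable_tensor. Qed.

Lemma cauchyE x : cauchy_kernel x = 2 ^+ n * decay x.
Proof.
rewrite /cauchy_kernel /tensor big_split /= prodr_const card_ord; congr (_ * _).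
Qed.

Lemma integrable_cauchy : integrable_Rn cauchy_kernel.
Proof.
have := integrable_RnZ (2 ^+ n) (@integrable_decay R n).
by congr integrable_Rn; apply/funext => x; rewrite cauchyE.
Qed.

Lemma cauchy_ge0 x : 0 <= cauchy_kernel x.
Proof. by rewrite cauchyE mulr_ge0 ?decay_ge0 ?exprn_ge0. Qed.

Lemma decay_le1 (x : Rn) : decay x <= 1.
Proof.
apply: prodr_ile1 => j _; rewrite oneDsqrV_ge0/= invf_le1.
  by rewrite lerDl sqr_ge0.
by rewrite ltr_wpDr ?sqr_ge0.
Qed.

(** On the unit cube the kernel is at least 1. *)
Lemma int_cauchy_gt0 : 0 < int_Rn cauchy_kernel.
Proof.
have box1 : (mu [set t | forall j, `[0%R, 1%R]%classic (tnth t j)] = 1)%E.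
  rewrite [LHS](@lebesgue_tuple_box R n (fun=> `[0%R, 1%R]%classic))//.
  apply: big1 => j _.
  by rewrite lebesgue_measure_itv /= lte_fin ltr01 oppr0 adde0.
set A := [set t | _] in box1.
have mA : measurable A.
  rewrite (_ : A = \bigcap_(j in [set: 'I_n])
      ((fun t : n.-tuple (measurableTypeR R) => tnth t j) @^-1` `[0%R, 1%R]%classic)).
    apply: fin_bigcap_measurable => // j _; rewrite -[X in measurable X]setTI.
    exact: (measurable_tnth j).
  by apply/seteqP; split => t /= h j; [move=> _|]; exact: h.
have fc : (\int[mu]_t (cauchy_kernel (tuple_row t))%:E)%E \is a fin_num.
  exact: (integrable_fin_num _ integrable_cauchy).
rewrite /int_Rn /Rintegral fine_gt0// -ge0_fin_numE ?fc ?andbT; last first.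
  by apply: integral_ge0 => t _; rewrite lee_fin cauchy_ge0.
apply: (@lt_le_trans _ _ 1%E); first exact: lte01.
rewrite -box1 -[A]setIT -integral_indic//.
apply: ge0_le_integral => //.
- by apply/measurable_EFinP; exact: measurable_indic.
- apply/measurable_EFinP; exact: (measurable_integrable_Rn integrable_cauchy).
- move=> t _; rewrite lee_fin indicE; case: (boolP (t \in A)) => [tA|_];
    last exact: cauchy_ge0.
  rewrite /cauchy_kernel /tensor; elim/big_rec: _ => // j y _ y1; apply: mulr_ege1 => //.
  have := set_mem tA j; rewrite /= in_itv /= !mxE => /andP[t0 t1].
  rewrite ler_pdivlMr ?mul1r; last by rewrite ltr_wpDr ?sqr_ge0.
  by rewrite -[2]/(1 + 1) lerD2l expr_le1.
Qed.

Lemma int_abel_cos (z : Rn) (c : R) :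
  int_Rn (fun xi => abel_kernel xi * cos (c + \sum_(j < n) z ord0 j * xi ord0 j)) =
  cos c * cauchy_kernel z.
Proof.
rewrite (@int_tensor_cos R (fun t => expR (- `|t|)) e0 ie n
  (fun a => 2 / (1 + a ^+ 2))) => [//|c' a].
by have [_ ->] := integral_expabs_cos c' a; rewrite mulrA [cos _ * _]mulrC.
Qed.

Local Notation T := (n.-tuple (measurableTypeR R)).

Lemma measurable_fst_Rn (f : Rn -> R) : measurable_Rn f ->
  measurable_fun setT (fun p : T * T => f (tuple_row p.1)).
Proof. by move=> mf; exact: (measurableT_comp mf measurable_fst). Qed.

Lemma measurable_snd_Rn (f : Rn -> R) : measurable_Rn f ->
  measurable_fun setT (fun p : T * T => f (tuple_row p.2)).
Proof. by move=> mf; exact: (measurableT_comp mf measurable_snd). Qed.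

Lemma measurable_coord (j : 'I_n) : measurable_Rn (fun x : Rn => x ord0 j).
Proof.
rewrite /measurable_Rn.
rewrite (_ : _ \o _ = (fun t : T => tnth t j)).
  exact: measurable_tnth.
by apply/funext => t /=; rewrite mxE.
Qed.

Lemma measurable_dot :
  measurable_fun setT (fun p : T * T => dot (tuple_row p.1) (tuple_row p.2)).
Proof.
apply: measurable_sum => j; apply: measurable_funM.
  exact: (measurable_fst_Rn (measurable_coord j)).
exact: (measurable_snd_Rn (measurable_coord j)).
Qed.

Lemma measurable_cos_dot (c : R) :
  measurable_fun setT (fun p : T * T => cos (c + dot (tuple_row p.1) (tuple_row p.2))).
Proof.
apply: (measurableT_comp measurable_cos); apply: measurable_funD => //.
exact: measurable_dot.
Qed.

Section transform.
Variables (u v : Rn -> R) (M : R).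
Hypotheses (cu : continuous u) (cv : continuous v).
Hypotheses (uM : forall x, `|u x| <= M * decay x)
           (vM : forall x, `|v x| <= M * decay x).

Lemma integrable_norm_pair : integrable_Rn (fun x => `|u x| + `|v x|).
Proof.
apply: (le_integrable_Rn _ _ (integrable_RnZ (M + M) (@integrable_decay R n))).
  by apply: measurable_funD; apply: measurableT_comp => //;
    exact: continuous_measurable_tuple.
by move=> x; rewrite ger0_norm ?addr_ge0// mulrDl lerD.
Qed.

Lemma le_norm_mix (p q a b : R) : `|a| <= 1 -> `|b| <= 1 ->
  `|p * a + q * b| <= `|p| + `|q|.
Proof.
move=> a1 b1; rewrite (le_trans (ler_normD _ _))// lerD// normrM.
  by rewrite -[X in _ <= X]mulr1 ler_wpM2l.
by rewrite -[X in _ <= X]mulr1 ler_wpM2l.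
Qed.

Lemma norm_cos_le1 (t : R) : `|cos t| <= 1.
Proof. by rewrite ler_norml cos_geN1 cos_le1. Qed.

Lemma integrable_waves c d xi :
  integrable_Rn (fun x => u x * wave c x xi + v x * wave d x xi).
Proof.
apply: (le_integrable_Rn _ _ integrable_norm_pair).
  apply: continuous_measurable_tuple => x.
  exact: (cvgD (continuousM_wave cu (x:=x)) (continuousM_wave cv (x:=x))).
by move=> x; apply: le_norm_mix; exact: norm_wave_le1.
Qed.

(** After multiplication by the integrable weight [abel_kernel] the double
    integral converges absolutely, and Fubini's theorem provides measurability;
    the weight is then divided out. *)
Lemma measurable_fourier_re : measurable_Rn (fourier_re u v).
Proof.
pose F (xi x : Rn) := abel_kernel xi * (u x * wave 0 x xi + v x * wave (- (pi / 2)) x xi).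
have mF : measurable_fun setT (fun p : T * T => F (tuple_row p.1) (tuple_row p.2)).
  have mw c : measurable_fun setT (fun p : T * T =>
      wave c (tuple_row p.2) (tuple_row p.1)).
    apply: (measurableT_comp measurable_cos); apply: measurable_funD => //.
    apply: measurable_funM => //.
    exact: (measurableT_comp measurable_dot (@measurable_swap _ _ T T)).
  apply: measurable_funM.
    exact: (measurable_fst_Rn (measurable_integrable_Rn integrable_abel)).
  apply: measurable_funD; apply: measurable_funM => //.
  - exact: (measurable_snd_Rn (continuous_measurable_tuple cu)).
  - exact: (measurable_snd_Rn (continuous_measurable_tuple cv)).
have Fle xi x : `|F xi x| <= abel_kernel xi * (`|u x| + `|v x|).
  rewrite normrM (gtr0_norm (abel_gt0 _)) ler_wpM2l ?(ltW (abel_gt0 _))//.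
  by apply: le_norm_mix; exact: norm_wave_le1.
have := measurable_integrable_Rn
  (integrable_fubini_Rn mF integrable_abel integrable_norm_pair Fle).
have me : measurable_Rn (fun xi : Rn => expR (\sum_(j < n) `|xi ord0 j|)).
  apply: (measurableT_comp (@measurable_expR R)).
  apply: measurable_sum => j; apply: measurableT_comp => //.
  exact: measurable_coord.
move=> mA; have := measurable_funM me mA.
congr measurable_fun; apply/funext => t /=.
rewrite int_RnZ; last exact: integrable_waves.
by rewrite mulrA abelE expRxMexpNx_1 mul1r.
Qed.

End transform.

Section limit.
Variables (u v : Rn -> R) (M : R).
Hypotheses (M0 : 0 <= M) (cu : continuous u) (cv : continuous v).
Hypotheses (uM : forall x, `|u x| <= M * decay x)
           (vM : forall x, `|v x| <= M * decay x).

Let cNu : continuous (fun x => - u x).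
Proof. exact: continuous_oppr. Qed.

Let uNM x : `|- u x| <= M * decay x.
Proof. by rewrite normrN. Qed.

(** [F z xi] is the real part of
    (u + i v)(x + s z) exp(- i z.xi) abel_kernel(xi); its double integral is
    computed in both orders. *)
Section step.
Variables (x : Rn) (s : R) (s_gt0 : 0 < s).

Let F (z xi : Rn) := abel_kernel xi *
  (u (x + s *: z) * cos (0 + dot z xi) + v (x + s *: z) * cos (- (pi / 2) + dot z xi)).

Let mF : measurable_fun setT (fun p : T * T => F (tuple_row p.1) (tuple_row p.2)).
Proof.
apply: measurable_funM.
  exact: (measurable_snd_Rn (measurable_integrable_Rn integrable_abel)).
apply: measurable_funD; apply: measurable_funM.
- apply: (@measurable_fst_Rn (fun z => u (x + s *: z))).
  apply: measurable_affine_Rn.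
  exact: continuous_measurable_tuple.
- exact: measurable_cos_dot.
- apply: (@measurable_fst_Rn (fun z => v (x + s *: z))).
  apply: measurable_affine_Rn.
  exact: continuous_measurable_tuple.
- exact: measurable_cos_dot.
Qed.

Let mF' : measurable_fun setT (fun p : T * T => F (tuple_row p.2) (tuple_row p.1)).
Proof.
have := measurableT_comp mF (@measurable_swap _ _ T T).
by [].
Qed.

Let s_neq0 : s != 0. Proof. by rewrite gt_eqF. Qed.

Let iuvs : integrable_Rn (fun z => `|u (x + s *: z)| + `|v (x + s *: z)|).
Proof. exact: (integrable_affine_Rn x s_neq0 (integrable_norm_pair cu cv uM vM)). Qed.

Let Fle z xi : `|F z xi| <= (`|u (x + s *: z)| + `|v (x + s *: z)|) * abel_kernel xi.
Proof.
rewrite /F normrM mulrC (gtr0_norm (abel_gt0 _)) ler_wpM2r ?(ltW (abel_gt0 _))//.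
by apply: le_norm_mix; exact: norm_cos_le1.
Qed.

Let Fle' xi z : `|F z xi| <= abel_kernel xi * (`|u (x + s *: z)| + `|v (x + s *: z)|).
Proof. by rewrite mulrC; exact: Fle. Qed.

(** The sine part disappears because the kernel is even, that is, because
    cos (- pi/2) = 0. *)
Lemma int_frequency z : int_Rn (F z) = u (x + s *: z) * cauchy_kernel z.
Proof.
transitivity (int_Rn (fun xi => u (x + s *: z) * (abel_kernel xi * cos (0 + dot z xi)) +
    v (x + s *: z) * (abel_kernel xi * cos (- (pi / 2) + dot z xi)))).
  by apply: eq_int_Rn => xi; rewrite /F; ring.
have i c : integrable_Rn (fun xi => abel_kernel xi * cos (c + dot z xi)).
  exact: (integrable_tensor_cos e0 ie).
rewrite int_RnD; [|exact: integrable_RnZ..].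
rewrite !int_RnZ// !int_abel_cos cos0 cosN cos_pihalf; ring.
Qed.

(** With y = x + s z the phase z.xi at xi = 2 pi s eta is
    2 pi y.eta - 2 pi x.eta. *)
Lemma int_position eta : s ^+ n * int_Rn (F ^~ ((2 * pi * s) *: eta)) =
  abel_kernel ((2 * pi * s) *: eta) * (fourier_re u v eta * wave 0 x eta +
    fourier_re v (fun y => - u y) eta * wave (pi / 2) x eta).
Proof.
set th := 2 * pi * dot x eta.
pose h y := u y * wave (- th) y eta + v y * wave (- (pi / 2) - th) y eta.
have ih : integrable_Rn h by exact: (integrable_waves cu cv uM vM).
have -> : int_Rn (F ^~ ((2 * pi * s) *: eta)) =
    abel_kernel ((2 * pi * s) *: eta) * int_Rn (fun z => h (x + s *: z)).
  rewrite -int_RnZ; last exact: (integrable_affine_Rn x s_neq0 ih).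
  apply: eq_int_Rn => z; rewrite /F /h /wave !dotDl !dotZl -/th.
  rewrite dotC dotZl dotC; congr (_ * (_ * cos _ + _ * cos _)).
    by rewrite /th; ring.
  by rewrite /th; ring.
rewrite mulrCA; congr (_ * _).
transitivity (int_Rn h); first by rewrite (int_affine_Rn x s_neq0 ih) gtr0_norm.
transitivity (int_Rn (fun y =>
  wave 0 x eta * (u y * wave 0 y eta + v y * wave (- (pi / 2)) y eta) +
  wave (pi / 2) x eta * (v y * wave 0 y eta + - u y * wave (- (pi / 2)) y eta))).
  apply: eq_int_Rn => y; rewrite /h /wave -/th.
  set ty := 2 * pi * dot y eta.
  rewrite !add0r !cosD !sinD !cosN !sinN cos_pihalf sin_pihalf; ring.
have i1 := integrable_waves cu cv uM vM 0 (- (pi / 2)) eta.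
have i2 : integrable_Rn (fun y => v y * wave 0 y eta + - u y * wave (- (pi / 2)) y eta).
  exact: (integrable_waves cv cNu vM uNM).
rewrite int_RnD; [|exact: integrable_RnZ..].
by rewrite !int_RnZ// ![wave _ _ _ * _]mulrC.
Qed.

Lemma inversion_step : int_Rn (fun z => u (x + s *: z) * cauchy_kernel z) =
  (2 * pi) ^+ n * int_Rn (fun eta => abel_kernel ((2 * pi * s) *: eta) *
     (fourier_re u v eta * wave 0 x eta +
      fourier_re v (fun y => - u y) eta * wave (pi / 2) x eta)).
Proof.
have ps0 : 2 * pi * s != 0 by rewrite mulf_neq0// gt_eqF// mulr_gt0 ?pi_gt0.
rewrite -(eq_int_Rn int_frequency) (fubini_Rn mF iuvs integrable_abel Fle).
have iPhi : integrable_Rn (fun xi => int_Rn (F ^~ xi)).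
  exact: (integrable_fubini_Rn mF' integrable_abel iuvs Fle').
have p2 : 0 <= 2 * pi :> R by rewrite mulr_ge0 ?pi_ge0.
rewrite (int_affine_Rn 0 ps0 iPhi) (ger0_norm (mulr_ge0 p2 (ltW s_gt0))).
rewrite [_ ^+ n]exprMn -[LHS]mulrA; congr (_ * _).
rewrite -int_RnZ; last exact: (integrable_affine_Rn 0 ps0 iPhi).
by apply: eq_int_Rn => eta; rewrite add0r int_position.
Qed.

End step.

(** Let s tend to 0 in [inversion_step]: the left-hand side is an average of u
    around x at scale s, and the Abel factor on the right-hand side tends to 1.
    Both limits are dominated. The mass of the kernel stays unevaluated, since the
    estimates depend only on its being positive. *)
Lemma fourier_inversion (N : R) (x : Rn) : 0 <= N ->
  (forall xi, `|fourier_re u v xi| <= N * decay xi) ->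
  (forall xi, `|fourier_re v (fun y => - u y) xi| <= N * decay xi) ->
  u x * int_Rn cauchy_kernel = (2 * pi) ^+ n * int_Rn (fun eta =>
    fourier_re u v eta * wave 0 x eta +
    fourier_re v (fun y => - u y) eta * wave (pi / 2) x eta).
Proof.
move=> N0 AN BN; pose s (m : nat) : R := m.+1%:R^-1.
have s0 m : 0 < s m by rewrite invr_gt0.
have s_cvg : s m @[m --> \oo] --> (0 : R) by exact: cvg_harmonic.
have mA := measurable_fourier_re cu cv uM vM.
have mB := measurable_fourier_re cv cNu vM uNM.
have L : int_Rn (fun z => u (x + s m *: z) * cauchy_kernel z) @[m --> \oo] -->
    int_Rn (fun z => u x * cauchy_kernel z).
  apply: (dominated_cvg_int_Rn (g := fun z => M * cauchy_kernel z)).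
  - move=> m; apply: measurable_funM.
      apply: measurable_affine_Rn; exact: continuous_measurable_tuple.
    exact: measurable_integrable_Rn integrable_cauchy.
  - move=> z.
    suff h : u (x + s m *: z) @[m --> \oo] --> u x.
      exact: (cvgM h (cvg_cst (cauchy_kernel z))).
    apply: (@continuous_cvg _ _ _ _ _ (fun m => x + s m *: z) u); first exact: cu.
    rewrite -[X in _ --> X]addr0; apply: cvgD; first exact: cvg_cst.
    rewrite -[X in _ --> X](scale0r z).
    by apply: cvgZ; [exact: s_cvg|exact: cvg_cst].
  - exact: integrable_RnZ integrable_cauchy.
  - move=> m z; rewrite normrM (ger0_norm (cauchy_ge0 _)) ler_wpM2r ?cauchy_ge0//.
    rewrite (le_trans (uM _))// -[X in _ <= X]mulr1 ler_wpM2l//.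
    exact: decay_le1.
pose H eta := fourier_re u v eta * wave 0 x eta +
  fourier_re v (fun y => - u y) eta * wave (pi / 2) x eta.
have mH : measurable_Rn H.
  by apply: measurable_funD; apply: measurable_funM => //; exact: measurable_wave.
have HN eta : `|H eta| <= (N + N) * decay eta.
  rewrite (le_trans (le_norm_mix _ _ (norm_wave_le1 _ _ _) (norm_wave_le1 _ _ _)))//.
  by rewrite mulrDl lerD.
have Rr : (2 * pi) ^+ n * int_Rn (fun eta => abel_kernel ((2 * pi * s m) *: eta) * H eta)
    @[m --> \oo] --> (2 * pi) ^+ n * int_Rn H.
  suff h : int_Rn (fun eta => abel_kernel ((2 * pi * s m) *: eta) * H eta)
      @[m --> \oo] --> int_Rn H by exact: (cvgM (cvg_cst _) h).
  apply: (dominated_cvg_int_Rn (g := fun z => (N + N) * decay z)).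
  - move=> m; apply: measurable_funM => //.
    have := measurable_affine_Rn 0 (2 * pi * s m)
      (measurable_integrable_Rn integrable_abel).
    by congr measurable_fun; apply/funext => t /=; rewrite add0r.
  - move=> z.
    suff h : abel_kernel ((2 * pi * s m) *: z) @[m --> \oo] --> (1 : R).
      by rewrite -[X in _ --> X]mul1r; exact: (cvgM h (cvg_cst (H z))).
    have E m : abel_kernel ((2 * pi * s m) *: z) =
        expR (s m * - (2 * pi * \sum_(j < n) `|z ord0 j|)).
      rewrite abelE; congr expR; rewrite mulrN; congr (- _).
      rewrite mulrCA !mulr_sumr; apply: eq_bigr => j _; rewrite mxE normrM.
      by rewrite ger0_norm ?mulr_ge0 ?pi_ge0 ?(ltW (s0 m))//; ring.
    rewrite (_ : (fun m => abel_kernel _) = (fun m => expR (s m *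
        - (2 * pi * \sum_(j < n) `|z ord0 j|))));
      last by apply/funext => m; exact: E.
    rewrite -[X in _ --> X]expR0; apply: continuous_cvg; first exact: continuous_expR.
    rewrite -[X in _ --> X](mul0r (- (2 * pi * \sum_(j < n) `|z ord0 j|))).
    exact: (cvgM s_cvg (cvg_cst _)).
  - exact: integrable_RnZ (@integrable_decay R n).
  - move=> m z; rewrite normrM (gtr0_norm (abel_gt0 _)) (le_trans _ (HN z))//.
    by rewrite -[X in _ <= X]mul1r ler_wpM2r// abel_le1.
rewrite -int_RnZ; last exact: integrable_cauchy.
have E : (fun m => int_Rn (fun z => u (x + s m *: z) * cauchy_kernel z)) =
  (fun m => (2 * pi) ^+ n *
    int_Rn (fun eta => abel_kernel ((2 * pi * s m) *: eta) * H eta)).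
  by apply/funext => m; exact: inversion_step.
rewrite E in L.
exact: (cvg_unique _ L Rr).
Qed.

End limit.

End inversion.

(** * Growth of the weight sequences *)

Section weights.
Context {R : realType} (sigma : R).
Hypothesis sigma_gt1 : 1 < sigma.

Let sigma_ge0 : 0 <= sigma. Proof. by rewrite (le_trans _ (ltW sigma_gt1)). Qed.

(** The logarithm of the weight is [tau * ell p], also for p = 0, since
    [ln 0 = 0]. *)
Definition ell (p : nat) : R := p%:R `^ sigma * ln p%:R.

Lemma ln_nat_ge0 (p : nat) : 0 <= ln (p%:R : R).
Proof.
by case: p => [|p]; [rewrite ln0|rewrite ln_ge0// ler1n].
Qed.

Lemma ell_ge0 p : 0 <= ell p.
Proof. by rewrite mulr_ge0 ?powR_ge0 ?ln_nat_ge0. Qed.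

Lemma ell_le p q : (p <= q)%N -> ell p <= ell q.
Proof.
case: p => [|p] pq; first by rewrite /ell ln0// mulr0 ell_ge0.
apply: ler_pM; rewrite ?powR_ge0 ?ln_nat_ge0//.
  by rewrite ge0_ler_powR ?nnegrE ?ler0n// ler_nat.
by rewrite ler_ln ?posrE ?ltr0n ?ler_nat// (leq_trans _ pq).
Qed.

Lemma weightE tau p : weight tau sigma p = expR (tau * ell p).
Proof.
case: p => [|p]; first by rewrite /= /ell ln0// !mulr0 expR0.
by rewrite /= {1}/powR pnatr_eq0 /= /ell mulrA.
Qed.

(** For p >= 2, ln (N p) = ln N + ln p is at most (ln N / ln 2 + 1) ln p. The
    term [ell N] takes care of p = 1, where [ell p] vanishes. *)
Lemma ell_mul N p : (0 < N)%N ->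
  ell (N * p) <= ell N + N%:R `^ sigma * (ln N%:R / ln 2 + 1) * ell p.
Proof.
move=> N0; have l2 : 0 < ln 2 :> R by rewrite ln_gt0// ltr1n.
have c0 : 0 <= N%:R `^ sigma * (ln N%:R / ln 2 + 1) :> R.
  by rewrite mulr_ge0 ?powR_ge0// addr_ge0// divr_ge0 ?ln_nat_ge0// ltW.
case: p => [|[|p]].
- by rewrite muln0 /ell ln0// !mulr0 addr0 ell_ge0.
- by rewrite muln1 lerDl mulr_ge0// ell_ge0.
set q := p.+2.
rewrite -[leLHS]add0r lerD ?ell_ge0// /ell natrM.
rewrite lnM ?posrE ?ltr0n// powRM ?ler0n//.
rewrite -!mulrA ler_wpM2l ?powR_ge0// mulrCA ler_wpM2l ?powR_ge0//.
rewrite mulrDl mul1r lerD2r mulrAC ler_pdivlMr// ler_wpM2l ?ln_nat_ge0//.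
by rewrite ler_ln ?posrE ?ltr0n// ler_nat.
Qed.

Lemma nat_le_ell p : p%:R <= 1 + (ln 2)^-1 * ell p.
Proof.
have l2 : 0 < ln 2 :> R by rewrite ln_gt0// ltr1n.
case: p => [|[|p]].
- by rewrite addr_ge0// mulr_ge0 ?ell_ge0// invr_ge0 ltW.
- by rewrite lerDl mulr_ge0 ?ell_ge0// invr_ge0 ltW.
set q := p.+2; rewrite -[leLHS]add0r lerD// mulrC ler_pdivlMr// /ell.
apply: ler_pM; rewrite ?ler0n ?(ltW l2)//.
  by rewrite -[leLHS]powRr1 ?ler0n// ler_powR ?ler1n// ltW.
by rewrite ler_ln ?posrE ?ltr0n// ler_nat.
Qed.

Lemma mul_ln_le_ell p : p%:R * ln p%:R <= ell p.
Proof.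
case: p => [|p]; first by rewrite mul0r ell_ge0.
rewrite ler_wpM2r ?ln_nat_ge0//.
by rewrite -[leLHS]powRr1 ?ler0n// ler_powR ?ler1n// ltW.
Qed.

(** Roumieu-type growth: domination by one of the sequences of the class. *)
Definition tame (s : nat -> R) : Prop :=
  exists2 tau : R, 0 < tau & exists2 C : R, 1 <= C &
    forall p, s p <= C * weight tau sigma p.

Lemma weight_ge1 tau p : 0 <= tau -> 1 <= weight tau sigma p.
Proof. by move=> t0; rewrite weightE -expR0 ler_expR mulr_ge0 ?ell_ge0. Qed.

Lemma weight_ge0 tau p : 0 <= weight tau sigma p.
Proof. by rewrite weightE expR_ge0. Qed.

Lemma weight_le tau p q : 0 <= tau -> (p <= q)%N ->
  weight tau sigma p <= weight tau sigma q.
Proof. by move=> t0 pq; rewrite !weightE ler_expR ler_wpM2l// ell_le. Qed.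

Lemma weight_le_tau tau tau' p : tau <= tau' ->
  weight tau sigma p <= weight tau' sigma p.
Proof. by move=> t; rewrite !weightE ler_expR ler_wpM2r// ell_ge0. Qed.

Lemma tame_expR (a b : R) (f : nat -> R) :
  (forall p, f p <= a + b * ell p) -> tame (fun p => expR (f p)).
Proof.
move=> fab; exists (Num.max 1 b); first by rewrite lt_max ltr01.
exists (expR (Num.max 0 a)); first by rewrite -expR0 ler_expR le_max lexx.
move=> p; rewrite weightE -expRD ler_expR (le_trans (fab p))// lerD//.
  by rewrite le_max lexx orbT.
by rewrite ler_wpM2r ?ell_ge0// le_max lexx orbT.
Qed.

Lemma tame_le s t : (forall p, s p <= t p) -> tame t -> tame s.
Proof.
move=> st [tau t0 [C C0 tC]]; exists tau => //; exists C => // p.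
exact: le_trans (st p) (tC p).
Qed.

Lemma tame_weight tau : 0 <= tau -> tame (weight tau sigma).
Proof.
move=> t0; apply: (@tame_le _ (fun p => expR (tau * ell p))).
  by move=> p; rewrite weightE.
by apply: (@tame_expR 0 tau) => p; rewrite add0r.
Qed.

Lemma tame_mul s t : (forall p, 0 <= s p) -> (forall p, 0 <= t p) ->
  tame s -> tame t -> tame (fun p => s p * t p).
Proof.
move=> s0 t0 [a a0 [C C0 sC]] [b b0 [D D0 tD]].
exists (a + b); first by rewrite addr_gt0.
exists (C * D); first exact: mulr_ege1.
move=> p; apply: le_trans (ler_pM (s0 p) (t0 p) (sC p) (tD p)) _.
rewrite mulrACA ler_pM2l ?(lt_le_trans ltr01 (mulr_ege1 C0 D0))//.
by rewrite !weightE -expRD -mulrDl.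
Qed.

Lemma tame_cst (c : R) : tame (fun=> c).
Proof.
exists 1 => //; exists (Num.max 1 c); first by rewrite le_max lexx.
move=> p; rewrite (@le_trans _ _ (Num.max 1 c))//; first by rewrite le_max lexx orbT.
by rewrite ler_peMr ?weight_ge1// le_max ler01.
Qed.

Lemma tame_comp_mul N s : (0 < N)%N -> tame s -> tame (fun p => s (N * p)%N).
Proof.
move=> N0 [a a0 [C C0 sC]].
have C0' : 0 <= C by exact: le_trans C0.
apply: (@tame_le _ (fun p => C * weight a sigma (N * p))) => //.
apply: tame_mul => //; [by move=> p; exact: weight_ge0|exact: tame_cst|].
apply: (@tame_le _ (fun p => expR (a * ell (N * p)))).
  by move=> p; rewrite weightE.
apply: (@tame_expR (a * ell N) (a * (N%:R `^ sigma * (ln N%:R / ln 2 + 1)))) => p.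
apply: le_trans (ler_wpM2l (ltW a0) (ell_mul p N0)) _.
by rewrite mulrDr [a * (_ * ell p)]mulrA.
Qed.

(** For p >= 1, p + m <= (m + 1) p. *)
Lemma tame_comp_add m s : tame s -> tame (fun p => s (p + m)%N).
Proof.
move=> [a a0 [C C0 sC]].
have C0' : 0 <= C by exact: le_trans C0.
pose t p := C * weight a sigma (m.+1 * p) * weight a sigma m.
apply: (@tame_le _ t) => [p|].
  apply: le_trans (sC _) _; rewrite /t -mulrA ler_wpM2l//.
  case: p => [|p]; first by rewrite muln0 add0n /= mul1r.
  rewrite -[leLHS]mulr1 ler_pM ?weight_ge0 ?weight_ge1 ?(ltW a0)// weight_le ?(ltW a0)//.
  by rewrite mulSn leq_add2l mulnS leq_addr.
apply: tame_mul => // [p|p||].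
- by rewrite mulr_ge0 ?weight_ge0.
- exact: weight_ge0.
- apply: (@tame_comp_mul m.+1 (fun p => C * weight a sigma p)) => //.
  apply: tame_mul => //; [by move=> p; exact: weight_ge0|exact: tame_cst|].
  by apply: tame_weight; exact: ltW.
- exact: tame_cst.
Qed.

Lemma tame_geometric (A : R) : 1 <= A -> tame (fun p => A ^+ p).
Proof.
move=> A1; have A0 : 0 < A by exact: lt_le_trans A1.
apply: (@tame_le _ (fun p => expR (p%:R * ln A))).
  by move=> p; rewrite expRM_natl lnK ?posrE.
apply: (@tame_expR (ln A) (ln A / ln 2)) => p.
rewrite mulrC -mulrA -[X in X + _]mulr1 -mulrDr ler_wpM2l ?ln_ge0//.
exact: nat_le_ell.
Qed.

Lemma tame_selfpower : tame (fun p => p%:R ^+ p).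
Proof.
apply: (@tame_le _ (fun p => expR (p%:R * ln p%:R))).
  case=> [|p]; first by rewrite mul0r expR0 expr0.
  by rewrite expRM_natl lnK ?posrE ?ltr0n.
by apply: (@tame_expR 0 1) => p; rewrite add0r mul1r mul_ln_le_ell.
Qed.

Lemma tame_expn s n : (forall p, 0 <= s p) -> tame s -> tame (fun p => s p ^+ n).
Proof.
move=> s0 ts; elim: n => [|n IH].
  by apply: (@tame_le _ (fun=> 1)) => [p|]; [rewrite expr0|exact: tame_cst].
apply: (@tame_le _ (fun p => s p * s p ^+ n)) => [p|]; first by rewrite exprS.
by apply: tame_mul => // p; exact: exprn_ge0.
Qed.

Lemma tame_pair s t : tame s -> tame t ->
  exists2 tau : R, 0 < tau & exists2 C : R, 1 <= C & forall p,
    s p <= C * weight tau sigma p /\ t p <= C * weight tau sigma p.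
Proof.
move=> [a a0 [C C0 sC]] [b b0 [D D0 tD]].
exists (Num.max a b); first by rewrite lt_max a0.
exists (Num.max C D); first by rewrite le_max C0.
move=> p; split.
  apply: le_trans (sC p) _; apply: ler_pM; rewrite ?weight_ge0 ?(le_trans ler01)//.
    by rewrite le_max lexx.
  by rewrite weight_le_tau// le_max lexx.
apply: le_trans (tD p) _; apply: ler_pM; rewrite ?weight_ge0 ?(le_trans ler01)//.
  by rewrite le_max lexx orbT.
by rewrite weight_le_tau// le_max lexx orbT.
Qed.

End weights.

(** * Multi-indices as ordered sequences of directions *)

(** Iterated derivatives are taken along sequences of directions, the outermost
    one first. The derivative of a multi-index is the one along the
    nondecreasing sequence with these multiplicities. Working with nondecreasing
    sequences avoids any appeal to the symmetry of mixed derivatives, and they are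
    stable under the passage to suffixes. *)
Section multiindex.
Context {R : realType} (n : nat).
Local Notation Rn := 'rV[R]_n.
Local Notation partials := (foldr (@partial R n)).

Lemma transitive_ord_le : transitive (fun i j : 'I_n => (i <= j)%N).
Proof. by move=> a b c; exact: leq_trans. Qed.

Definition ordered (s : seq 'I_n) := pairwise (fun i j : 'I_n => (i <= j)%N) s.

Definition blocks (b : 'I_n -> nat) (L : seq 'I_n) := flatten [seq nseq (b j) j | j <- L].

Lemma partials_blocks b (f : Rn -> R) L :
  foldr (fun j => iter (b j) (partial j)) f L = partials f (blocks b L).
Proof.
elim: L => //= j L IH; rewrite foldr_cat -IH /blocks /=.
by elim: (b j) => //= k ->.
Qed.

Lemma mpartial_blocks (b : {ffun 'I_n -> nat}) (f : Rn -> R) :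
  mpartial_real b f = partials f (blocks b (enum 'I_n)).
Proof. exact: partials_blocks. Qed.

Lemma size_blocks b L : size (blocks b L) = (\sum_(j <- L) b j)%N.
Proof.
elim: L => [|j L IH]; first by rewrite big_nil.
by rewrite big_cons /blocks /= size_cat size_nseq -/(blocks b L) IH.
Qed.

Lemma size_blocks_enum (b : {ffun 'I_n -> nat}) :
  size (blocks b (enum 'I_n)) = mlength b.
Proof. by rewrite size_blocks big_enum. Qed.

Lemma mem_blocks b L (j : 'I_n) : j \in blocks b L -> j \in L.
Proof. by move=> /flatten_mapP[i iL]; rewrite mem_nseq => /andP[_ /eqP ->]. Qed.

Lemma ordered_nseq_cat m (j : 'I_n) s : ordered s -> (forall i, i \in s -> (j <= i)%N) ->
  ordered (nseq m j ++ s).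
Proof.
move=> so js; rewrite /ordered pairwise_cat; apply/and3P; split => //.
  by apply/allrelP => a i; rewrite mem_nseq => /andP[_ /eqP ->]; exact: js.
elim: m => //= m ->; rewrite andbT; apply/allP => i.
by rewrite mem_nseq => /andP[_ /eqP ->].
Qed.

Lemma ordered_blocks b L : ordered L -> ordered (blocks b L).
Proof.
elim: L => //= j L IH /andP[/allP jL oL].
by apply: ordered_nseq_cat; [exact: IH|move=> i /mem_blocks /jL].
Qed.

Lemma ordered_enum : ordered (enum 'I_n).
Proof.
rewrite /ordered -(sorted_pairwise transitive_ord_le).
have : sorted leq (map val (enum 'I_n)) by rewrite val_enum_ord iota_sorted.
by rewrite sorted_map.
Qed.

Lemma ordered_drop k s : ordered s -> ordered (drop k s).
Proof. by apply: subseq_pairwise; exact: drop_subseq. Qed.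

Lemma count_blocks b L (j : 'I_n) : uniq L ->
  count_mem j (blocks b L) = if j \in L then b j else 0%N.
Proof.
elim: L => //= i L IH /andP[iL uL].
rewrite count_cat count_nseq IH// /= eq_sym.
case: eqVneq => [ij|ji] /=; rewrite inE.
  by rewrite ij eqxx (negbTE iL) mul1n addn0.
by rewrite (negbTE ji) mul0n add0n.
Qed.

(** Both sides are nondecreasing with the same multiplicities. *)
Lemma ordered_blocksE s : ordered s ->
  s = blocks [ffun j => count_mem j s] (enum 'I_n).
Proof.
move=> os; apply: (sorted_eq transitive_ord_le).
- by move=> a b ab; apply/val_inj/anti_leq.
- by rewrite (sorted_pairwise transitive_ord_le).
- rewrite (sorted_pairwise transitive_ord_le).
  by apply: ordered_blocks; exact: ordered_enum.
- apply/allP => j _ /=; apply/eqP.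
  by rewrite count_blocks ?enum_uniq// mem_enum inE ffunE.
Qed.

Lemma partials_ordered s (f : Rn -> R) : ordered s ->
  partials f s = mpartial_real [ffun j => count_mem j s] f.
Proof. by move=> os; rewrite mpartial_blocks -ordered_blocksE. Qed.

Lemma monomial_blocks (b : {ffun 'I_n -> nat}) (x : Rn) :
  monomial b x = \prod_(j <- blocks b (enum 'I_n)) x ord0 j.
Proof.
rewrite /monomial -big_enum /= /blocks; elim: (enum 'I_n) => [|j L IH].
  by rewrite !big_nil.
by rewrite big_cons /= big_cat IH big_nseq /= iter_mulr_1.
Qed.

Lemma monomial_count (s : seq 'I_n) (x : Rn) :
  \prod_(j <- s) x ord0 j = monomial [ffun j => count_mem j s] x.
Proof.
rewrite (partition_big id xpredT)//=; apply: eq_bigr => i _; rewrite ffunE.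
transitivity (\prod_(j <- s | j == i) x ord0 i).
  by apply: eq_bigr => j /eqP ->.
by rewrite big_const_seq iter_mulr_1.
Qed.

Lemma mlength_count_mem (s : seq 'I_n) : mlength [ffun j => count_mem j s] = size s.
Proof.
rewrite -sum1_size (partition_big id xpredT)//=; apply: eq_bigr => i _.
by rewrite ffunE sum1_count.
Qed.

End multiindex.

(** * Landau inequalities *)

Section landau.
Context {R : realType}.

(** The derivatives are part of the data, so that the partial derivatives of a
    function on R^n, restricted to a line, form a chain. *)
Definition chain (g : nat -> R -> R) := forall k (t : R), is_derive t 1 (g k) (g k.+1 t).

Lemma chain_MVT g k (a b : R) : chain g -> a <= b ->
  exists2 c, a <= c <= b & g k b - g k a = g k.+1 c * (b - a).
Proof.
move=> gc; rewrite le_eqVlt => /orP[/eqP ->|ab].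
  by exists b; rewrite ?lexx// !subrr mulr0.
have [|c cab E] := @MVT R (g k) (g k.+1) a b ab (fun x _ => gc k x).
  apply: derivable_within_continuous => x _; by have [] := gc k x.
by exists c => //; move: cab; rewrite in_itv /= => /andP[/ltW -> /ltW ->].
Qed.

(** A k-th difference of step h is at most 2^k A, and by the mean value theorem
    it equals h^k times a value of the k-th derivative. *)
Lemma chain_point (h A : R) k g : 0 < h -> chain g ->
  (forall t, 0 <= t -> `|g 0%N t| <= A) ->
  forall t : R, 0 <= t -> exists2 c, t <= c <= t + k%:R * h &
    `|g k c| * h ^+ k <= 2 ^+ k * A.
Proof.
move=> h0; elim: k g A => [|k IH] g A gc gA t t0.
  by exists t; [rewrite mul0r addr0 lexx|rewrite !expr0 mulr1 mul1r gA].
pose g' k t := g k (t + h) - g k t.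
have gc' : chain g'.
  move=> i u; rewrite /g'; have D1 := gc i (u + h); have D2 := gc i u.
  have D3 : is_derive u 1 (fun u : R => u + h) 1 by apply: is_derive_eq; rewrite addr0.
  have D4 := is_derive1_comp (g := fun u : R => u + h) (x := u) D1 D3.
  by apply: is_derive_eq; rewrite mulr1.
have gA' u : 0 <= u -> `|g' 0%N u| <= 2 * A.
  move=> u0; rewrite (le_trans (ler_normB _ _))// mulr_natl mulr2n lerD// gA//.
  by rewrite addr_ge0// ltW.
have [c /andP[c1 c2] hc] := IH g' (2 * A) gc' gA' t t0.
have [c' /andP[d1 d2] E] := chain_MVT k gc (ltW (ltr_pwDr h0 (lexx c))).
exists c'.
  rewrite (le_trans c1)//= (le_trans d2)// -natr1 mulrDl mul1r addrA lerD2r//.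
move: hc; rewrite /g' E addrAC subrr add0r normrM (gtr0_norm h0) -mulrA -exprS.
by rewrite mulrA -exprSr.
Qed.

(** Descending induction on k from m. Between the point given by [chain_point],
    at distance at most k h, and t, the k-th derivative varies by at most
    k h sup |g^(k+1)|. *)
Lemma chain_bound (h A B : R) (m : nat) g : 0 < h -> 0 <= A -> 0 <= B -> chain g ->
  (forall t, 0 <= t -> `|g 0%N t| <= A) -> (forall t, 0 <= t -> `|g m t| <= B) ->
  forall k t, (k <= m)%N -> 0 <= t ->
  `|g k t| * h ^+ k <= m.+2%:R ^+ m * 2 ^+ m * (A + B * h ^+ m).
Proof.
move=> h0 A0 B0 gc gA gB; set X := A + B * h ^+ m.
have X0 : 0 <= X by rewrite addr_ge0// mulr_ge0// exprn_ge0// ltW.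
have H i : (i <= m)%N -> forall t, 0 <= t ->
    `|g (m - i)%N t| * h ^+ (m - i) <= m.+2%:R ^+ i * 2 ^+ m * X.
  elim: i => [_ t t0|i IH im t t0].
    rewrite subn0 expr0 mul1r -[leLHS]mul1r ler_pM ?exprn_ge0//.
    - by rewrite mulr_ge0// exprn_ge0// ltW.
    - by rewrite exprn_ege1// ler1n.
    - by rewrite /X -[leLHS]add0r lerD// ler_wpM2r ?gB// exprn_ge0// ltW.
  set k := (m - i.+1)%N.
  have kE : (m - i = k.+1)%N by rewrite /k subnSK.
  have [c /andP[c1 c2] hc] := chain_point k h0 gc gA t0.
  have [d /andP[d1 d2] E] := chain_MVT k gc c1.
  have := IH (ltnW im) d (le_trans t0 d1); rewrite kE => hd.
  have hk : 0 <= h ^+ k by rewrite exprn_ge0// ltW.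
  have : `|g k t| <= `|g k c| + `|g k.+1 d| * (c - t).
    have -> : g k t = g k c - g k.+1 d * (c - t) by rewrite -E; ring.
    by rewrite (le_trans (ler_normB _ _))// normrM [`|c - t|]ger0_norm// subr_ge0.
  move=> /(ler_wpM2r hk) /le_trans; apply; rewrite mulrDl.
  have -> : m.+2%:R ^+ i.+1 * 2 ^+ m * X =
    m.+2%:R ^+ i * 2 ^+ m * X + m.+1%:R * (m.+2%:R ^+ i * 2 ^+ m * X).
    by rewrite exprS -[m.+2%:R]natr1; ring.
  apply: lerD.
    apply: le_trans hc _; apply: ler_pM => //.
      rewrite -[leLHS]mul1r ler_pM ?exprn_ge0//.
        by rewrite exprn_ege1// ler1n.
      by rewrite ler_weXn2l ?ler1n// leq_subr.
    by rewrite lerDl mulr_ge0// exprn_ge0// ltW.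
  apply: (@le_trans _ _ (k%:R * (`|g k.+1 d| * h ^+ k.+1))).
    have -> : k%:R * (`|g k.+1 d| * h ^+ k.+1) = `|g k.+1 d| * (k%:R * h) * h ^+ k.
      by rewrite exprS; ring.
    by rewrite ler_wpM2r// ler_wpM2l// lerBlDl.
  apply: ler_pM => //; first by rewrite mulr_ge0// exprn_ge0// ltW.
  by rewrite ler_nat (leq_trans (leq_subr _ _)).
move=> k t km t0; have := H (m - k)%N (leq_subr _ _) t t0; rewrite subKn//.
move=> /le_trans; apply; rewrite ler_wpM2r// ler_wpM2r ?exprn_ge0//.
by rewrite ler_weXn2l ?ler1n// leq_subr.
Qed.

End landau.

(** * Landau inequalities on an orthant *)

Section landau_Rn.
Context {R : realType} (n : nat).
Local Notation Rn := 'rV[R]_n.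
Local Notation e j := (delta_mx ord0 j : Rn).
Local Notation partials := (foldr (@partial R n)).

(** The sign [sg] selects one of the two half lines issued from y in the direction
    of the j-th axis. *)
Lemma chain_partial (f : Rn -> R) (s : seq 'I_n) (j : 'I_n) (sg : R) (y : Rn) :
  smooth_real f ->
  chain (fun k t => sg ^+ k * partials f (nseq k j ++ s) (y + (sg * t) *: e j)).
Proof.
move=> sf k t; have [_ df] := sf (nseq k j ++ s).
have D1 := is_derive_line (df j (y + (sg * t) *: e j)).
have D2 : is_derive t 1 (fun t : R => sg * t) sg.
  by apply: is_derive_eq; rewrite /GRing.scale /= mulr1.
have D3 := is_derive1_comp (g := fun t : R => sg * t) (x := t) D1 D2.
have D4 := is_deriveZ (sg ^+ k) D3.
have E : partials f (nseq k.+1 j ++ s) = 'D_(e j) (partials f (nseq k j ++ s)) by [].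
by apply: (is_derive_eq D4); rewrite E /GRing.scale /= exprS; ring.
Qed.

(** The orthant with vertex x that points away from the origin. *)
Definition outward (x y : Rn) :=
  forall j, 0 <= (-1) ^+ (x ord0 j < 0)%R * (y ord0 j - x ord0 j).

Lemma outward_refl x : outward x x.
Proof. by move=> j; rewrite subrr mulr0. Qed.

Lemma outward_shift x y j t : outward x y -> 0 <= t ->
  outward x (y + ((-1) ^+ (x ord0 j < 0)%R * t) *: e j).
Proof.
move=> xy t0 i; rewrite !mxE eqxx /=.
have [->|ij] := eqVneq i j; last by rewrite mulr0 addr0; exact: xy.
rewrite mulr1; have xyj := xy j; move: xyj.
have : (-1) ^+ (x ord0 j < 0)%R * (-1) ^+ (x ord0 j < 0)%R = 1 :> R.
  by rewrite -expr2 sqrr_sign.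
set b : R := (-1) ^+ _ => b2 xyj.
rewrite [leRHS](_ : _ = b * (y ord0 j - x ord0 j) + b * b * t); last by ring.
by rewrite b2 mul1r addr_ge0.
Qed.

Lemma outward_norm x y j : outward x y -> `|x ord0 j| <= `|y ord0 j|.
Proof.
move=> /(_ j); case: ltP => [x0|x0] /=; rewrite ?expr1 ?expr0 ?mul1r ?mulN1r.
  rewrite oppr_ge0 subr_le0 => yx.
  by rewrite !ltr0_norm// ?(le_lt_trans yx)// lerN2.
rewrite subr_ge0 => xy.
by rewrite !ger0_norm// (le_trans x0).
Qed.

Lemma monomial_outward a x y : outward x y -> `|monomial a x| <= `|monomial a y|.
Proof.
move=> xy; rewrite /monomial !normr_prod; apply: ler_prod => j _.
by rewrite normr_ge0 !normrX lerXn2r ?nnegrE ?normr_ge0// outward_norm.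
Qed.

(** One coordinate at a time, with the same step h. When the directions in L
    have been treated, with p derivatives in all, [chain_bound] is applied in the
    next direction up to the order N - p, so that the derivatives to be bounded by
    B always have total order N. *)
Lemma landau_blocks (f : Rn -> R) (x : Rn) (A B h : R) (N : nat)
    (b : 'I_n -> nat) (L : seq 'I_n) :
  smooth_real f -> 0 < h -> 0 <= A -> 0 <= B ->
  (forall y, outward x y -> `|f y| <= A) ->
  (forall s, ordered s -> size s = N -> forall y, `|partials f s y| <= B) ->
  ordered L -> (size (blocks b L) <= N)%N ->
  forall y, outward x y -> `|partials f (blocks b L) y| * h ^+ size (blocks b L) <=
    (2 * (N.+2%:R ^+ N * 2 ^+ N)) ^+ size L * (A + B * h ^+ N).
Proof.
move=> sf h0 A0 B0 fA fB; set K := N.+2%:R ^+ N * 2 ^+ N; set X := A + B * h ^+ N.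
have hp k : 0 < h ^+ k by rewrite exprn_gt0.
have X0 : 0 <= X by rewrite addr_ge0// mulr_ge0// ltW.
have K1 : 1 <= K by rewrite mulr_ege1// exprn_ege1// ler1n.
have K0 : 0 <= K by exact: le_trans K1.
elim: L => [_ _ y xy|j L IH oL sL y xy].
  rewrite /blocks /= !expr0 mulr1 mul1r (le_trans (fA y xy))// lerDl.
  by rewrite mulr_ge0// ltW.
have [/allP jL oL'] := andP oL.
pose s := blocks b L; pose p := size s.
have szE : size (blocks b (j :: L)) = (b j + p)%N by rewrite size_cat size_nseq.
have pN : (b j + p <= N)%N by rewrite -szE.
have {}IH := IH oL' (leq_trans (leq_addl _ _) pN).
pose sg : R := (-1) ^+ (x ord0 j < 0)%R.
have asg k : `|sg ^+ k| = 1 by rewrite normrX normr_sign expr1n.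
have gc := chain_partial s j sg y sf.
pose A' := (2 * K) ^+ size L * X / h ^+ p.
have A'0 : 0 <= A'.
  by rewrite divr_ge0 ?(ltW (hp _))// mulr_ge0// exprn_ge0// mulr_ge0.
have gA t : 0 <= t ->
    `|sg ^+ 0 * partials f (nseq 0 j ++ s) (y + (sg * t) *: e j)| <= A'.
  move=> t0; rewrite normrM asg mul1r ler_pdivlMr//; apply: IH.
  exact: outward_shift.
have gB t : 0 <= t -> `|sg ^+ (N - p) *
    partials f (nseq (N - p) j ++ s) (y + (sg * t) *: e j)| <= B.
  move=> _; rewrite normrM asg mul1r; apply: fB.
    apply: ordered_nseq_cat; first exact: ordered_blocks.
    by move=> i /mem_blocks /jL.
  by rewrite size_cat size_nseq subnK// (leq_trans (leq_addl _ _) pN).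
have := chain_bound h0 A'0 B0 gc gA gB (k := b j) _ (lexx 0).
rewrite leq_subRL ?(leq_trans (leq_addl _ _) pN)// addnC pN => /(_ isT).
rewrite normrM asg mul1r mulr0 scale0r addr0 => H.
rewrite szE exprD mulrA.
have {H} := ler_wpM2r (ltW (hp p)) H.
move=> /le_trans; apply.
have -> : (N - p).+2%:R ^+ (N - p) * 2 ^+ (N - p) * (A' + B * h ^+ (N - p)) * h ^+ p =
    ((N - p).+2%:R ^+ (N - p) * 2 ^+ (N - p)) * ((2 * K) ^+ size L * X + B * h ^+ N).
  have -> : h ^+ N = h ^+ (N - p) * h ^+ p.
    by rewrite -exprD subnK// (leq_trans (leq_addl _ _) pN).
  by rewrite /A'; field; rewrite gt_eqF.
have -> : (2 * K) ^+ size (j :: L) * X =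
    K * ((2 * K) ^+ size L * X + (2 * K) ^+ size L * X).
  by rewrite /= exprS; ring.
apply: ler_pM.
- by rewrite mulr_ge0 ?exprn_ge0.
- by rewrite addr_ge0// ?mulr_ge0 ?exprn_ge0 ?mulr_ge0 ?(ltW h0).
- rewrite /K ler_pM ?exprn_ge0//.
    apply: (@le_trans _ _ (N.+2%:R ^+ (N - p))).
      by rewrite lerXn2r ?nnegrE ?ler0n// ler_nat !ltnS leq_subr.
    by rewrite ler_weXn2l ?ler1n// leq_subr.
  by rewrite ler_weXn2l ?ler1n// leq_subr.
- rewrite lerD2l (@le_trans _ _ X)//; first by rewrite lerDr.
  by rewrite ler_peMl// exprn_ege1// mulr_ege1// ler1n.
Qed.

Definition landau_const (N : nat) : R :=
  2 * (2 * (N.+2%:R ^+ N * 2 ^+ N)) ^+ n.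

Lemma landau_const_ge1 N : 1 <= landau_const N.
Proof.
rewrite mulr_ege1 ?ler1n// exprn_ege1// mulr_ege1 ?ler1n//.
by rewrite mulr_ege1// exprn_ege1// ler1n.
Qed.

(** The previous lemma with N = 2 |s| and the optimal step, h^|s| = p / (y q), for
    which both terms of the sum are equal. *)
Lemma landau_ordered (f : Rn -> R) (x : Rn) (y p q : R) (s : seq 'I_n) :
  smooth_real f -> 0 < y -> 0 < p -> 0 < q -> (0 < size s)%N -> ordered s ->
  (forall z, outward x z -> `|f z| <= (p / y) ^+ 2) ->
  (forall s', ordered s' -> size s' = (2 * size s)%N ->
     forall z, `|partials f s' z| <= q ^+ 2) ->
  y * `|partials f s x| <=
  landau_const (2 * size s) * p * q.
Proof.
move=> sf y0 p0 q0 s0 os fp fq.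
rewrite /landau_const; set N := (2 * size s)%N; set K := _ ^+ n.
pose r := p / (y * q); have r0 : 0 < r by rewrite divr_gt0// mulr_gt0.
pose h := r `^ (size s)%:R^-1.
have h0 : 0 < h by exact: powR_gt0.
have hE : h ^+ size s = r.
  rewrite -powR_mulrn ?powR_ge0// -powRrM mulVf ?pnatr_eq0 -?lt0n//.
  by rewrite powRr1// ltW.
have := @landau_blocks f x ((p / y) ^+ 2) (q ^+ 2) h N
  [ffun j => count_mem j s] (enum 'I_n) sf h0 (sqr_ge0 _) (sqr_ge0 _) fp fq
  (@ordered_enum n).
rewrite -ordered_blocksE// => /(_ _ x (outward_refl x)).
rewrite /N leq_pmull// => /(_ isT).
have hN : h ^+ N = r ^+ 2 by rewrite /N mulnC exprM hE.
rewrite size_enum_ord -/N -/K hE hN => H.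
have -> : 2 * K * p * q = (K * ((p / y) ^+ 2 + q ^+ 2 * r ^+ 2)) / r * y.
  by rewrite /r; field; rewrite !gt_eqF.
by rewrite mulrC ler_wpM2r ?(ltW y0)// ler_pdivlMr.
Qed.

End landau_Rn.

(** * The mixed estimate *)

Section assembly.
Context {R : realType} (n : nat) (sigma : R).
Hypothesis sigma_gt1 : 1 < sigma.
Local Notation Rn := 'rV[R]_n.
Local Notation partials := (foldr (@partial R n)).
Local Notation W tau := (weight tau sigma).

(** At each point use the exponents 2 in the coordinates with |x_j| >= 1 and 0 in
    the others; then 1 + x_j^2 <= 2 |x_j|^(a_j). *)
Lemma decay_of_monomials (x : Rn) (g c : R) : 0 <= g ->
  (forall a : {ffun 'I_n -> nat}, (mlength a <= 2 * n)%N -> `|monomial a x| * g <= c) ->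
  g <= 2 ^+ n * c * decay x.
Proof.
move=> g0 gc.
pose a := [ffun j : 'I_n => if 1 <= `|x ord0 j| then 2%N else 0%N].
have a2 : (mlength a <= 2 * n)%N.
  rewrite /mlength (@leq_trans (\sum_(j < n) 2))//.
    by apply: leq_sum => j _; rewrite ffunE; case: ifP.
  by rewrite sum_nat_const card_ord mulnC.
have d0 : 0 < decay x.
  by apply: prodr_gt0 => j _; rewrite invr_gt0 ltr_wpDr ?sqr_ge0.
have -> : 2 ^+ n * c * decay x = c * (2 ^+ n * decay x) by ring.
rewrite -ler_pdivrMr; last by rewrite mulr_gt0// exprn_gt0.
apply: le_trans (gc a a2); rewrite mulrC ler_wpM2r//.
rewrite /decay /tensor -[n in 2 ^+ n]card_ord -prodr_const -big_split /= -prodfV.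
rewrite /monomial normr_prod; apply: ler_prod => j _.
have p1 : 0 < 1 + x ord0 j ^+ 2 by rewrite ltr_wpDr ?sqr_ge0.
rewrite invfM invrK; apply/andP; split; first by rewrite mulr_ge0 ?(ltW p1).
rewrite mulrC ler_pdivrMr// ffunE; case: ifP => h.
  rewrite normrX real_normK ?num_real// mulr_natr mulr2n lerD2r.
  by rewrite -real_normK ?num_real// exprn_ege1.
rewrite expr0 normr1 mul1r -[2]/(1 + 1) lerD2l -real_normK ?num_real//.
by rewrite expr_le1// ltW// ltNge h.
Qed.

Lemma monomialMn (a : {ffun 'I_n -> nat}) (x : Rn) :
  monomial [ffun j => (2 * a j)%N] x = monomial a x ^+ 2.
Proof.
rewrite /monomial expr2 -big_split /=; apply: eq_bigr => j _.
by rewrite ffunE mulSn mul1n exprD.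
Qed.

Lemma mlengthMn (a : {ffun 'I_n -> nat}) :
  mlength [ffun j => (2 * a j)%N] = (2 * mlength a)%N.
Proof. by rewrite /mlength big_distrr; apply: eq_bigr => j _; rewrite ffunE. Qed.

Lemma tame_landau_const : tame sigma (fun p => landau_const n (2 * p)).
Proof.
have g0 p : 0 <= (2 * p)%N.+2%:R ^+ (2 * p) * 2 ^+ (2 * p) :> R.
  by rewrite mulr_ge0// exprn_ge0.
have h0 p : 0 <= 2 * ((2 * p)%N.+2%:R ^+ (2 * p) * 2 ^+ (2 * p)) :> R.
  by rewrite mulr_ge0.
have k0 p : 0 <= (2 * ((2 * p)%N.+2%:R ^+ (2 * p) * 2 ^+ (2 * p))) ^+ n :> R.
  by rewrite exprn_ge0.
have l0 p : 0 <= (2 * p)%N.+2%:R ^+ (2 * p) :> R by rewrite exprn_ge0.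
have m0 p : 0 <= 2 ^+ (2 * p) :> R by rewrite exprn_ge0.
apply: (tame_mul (s := fun=> 2)) => //; first exact: tame_cst.
apply: tame_expn => //.
apply: (tame_mul (s := fun=> 2)) => //; first exact: tame_cst.
apply: tame_mul => //.
- apply: (@tame_le _ _ _ (fun p => (2 * p + 2)%N%:R ^+ (2 * p + 2))) => // [p|].
    by rewrite addn2 ler_weXn2l ?ler1n// (leq_trans (leqnSn _)).
  have H := tame_comp_add sigma_gt1 2 (tame_selfpower sigma_gt1).
  exact: (tame_comp_mul (isT : (0 < 2)%N) H).
- have H : tame sigma (fun q => (2 : R) ^+ q) by apply: tame_geometric; rewrite ?ler1n.
  exact: (tame_comp_mul (isT : (0 < 2)%N) H).
Qed.

Section mixed.
Variables (tau C : R) (tau0 : 0 < tau) (C1 : 1 <= C).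

Let C0 : 0 < C. Proof. exact: lt_le_trans C1. Qed.

Let CW1 k : 1 <= C * W tau k.
Proof. by rewrite mulr_ege1// weight_ge1// ltW. Qed.

(** In [landau_ordered] y is |x^a|. On the outward orthant
    |x^a|^2 |f(z)| <= |z^(2a) f(z)|, which the decay of f bounds. *)
Lemma mixed_bound (f : Rn -> R) :
  smooth_real f ->
  (forall a x, `|monomial a x| * `|f x| <= C * W tau (mlength a)) ->
  (forall s x, ordered s -> `|partials f s x| <= C * W tau (size s)) ->
  forall a s x, ordered s ->
    `|monomial a x| * `|partials f s x| <=
    (C * W tau (2 * mlength a)) * (landau_const n (2 * size s) * (C * W tau (2 * size s))).
Proof.
move=> sf fa fs a s x os.
have CW0 k : 0 < C * W tau k by exact: lt_le_trans ltr01 (CW1 k).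
have [s0|s0] := posnP (size s).
  move/eqP: (s0); rewrite size_eq0 => /eqP -> /=.
  apply: le_trans (fa a x) _; rewrite -[leLHS]mulr1 ler_pM ?(ltW (CW0 _))//.
    by rewrite ler_pM2l// weight_le ?(ltW tau0)// leq_pmull.
  by rewrite mulr1 mulr_ege1 ?landau_const_ge1.
have [->|y0] := eqVneq (monomial a x) 0.
  rewrite normr0 mul0r mulr_ge0 ?(ltW (CW0 _))// mulr_ge0 ?(ltW (CW0 _))//.
  by rewrite (le_trans ler01)// landau_const_ge1.
have yp : 0 < `|monomial a x| by rewrite normr_gt0.
have := @landau_ordered R n f x `|monomial a x| (C * W tau (2 * mlength a))
  (C * W tau (2 * size s)) s sf yp (CW0 _) (CW0 _) s0 os.
have h1 z : outward x z -> `|f z| <= (C * W tau (2 * mlength a) / `|monomial a x|) ^+ 2.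
  move=> xz; rewrite expr_div_n ler_pdivlMr ?exprn_gt0// mulrC.
  apply: (@le_trans _ _ (`|monomial a z| ^+ 2 * `|f z|)).
    by rewrite ler_wpM2r// lerXn2r ?nnegrE ?normr_ge0// monomial_outward.
  rewrite -normrX -monomialMn; apply: le_trans (fa _ _) _.
  by rewrite mlengthMn expr2 ler_peMr ?(ltW (CW0 _)) ?CW1.
have h2 s' : ordered s' -> size s' = (2 * size s)%N ->
    forall z, `|partials f s' z| <= (C * W tau (2 * size s)) ^+ 2.
  move=> os' ss' z; apply: le_trans (fs _ _ os') _.
  by rewrite ss' expr2 ler_peMr ?(ltW (CW0 _)) ?CW1.
move=> /(_ h1 h2) /le_trans; apply.
rewrite le_eqVlt; apply/orP; left; apply/eqP; ring.
Qed.

End mixed.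

End assembly.

(** * Complex-valued functions *)

Section complex_values.
Context {R : realType} (n : nat).
Local Notation Rn := 'rV[R]_n.

Lemma supnorm_leP (f : Rn -> R[i]) (c : R) :
  (supnorm f <= c%:E)%E <-> forall x, Normc.normc (f x) <= c.
Proof.
split=> [fc x|fc].
  rewrite -lee_fin; apply: le_trans fc; apply: ereal_sup_ubound.
  by exists x.
by apply: ge_ereal_sup => _ [x _ <-]; rewrite lee_fin.
Qed.

Lemma normc_real (r : R) (z : R[i]) : Normc.normc (r%:C%C * z) = `|r| * Normc.normc z.
Proof.
by rewrite Normc.normcM; congr (_ * _); rewrite /= expr0n addr0 sqrtr_sqr.
Qed.

Lemma ge_normc_Re (z : R[i]) : `|complex.Re z| <= Normc.normc z.
Proof.
by case: z => a b /=; rewrite -sqrtr_sqr ler_sqrt ?addr_ge0 ?sqr_ge0// lerDl sqr_ge0.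
Qed.

Lemma ge_normc_Im (z : R[i]) : `|complex.Im z| <= Normc.normc z.
Proof.
by case: z => a b /=; rewrite -sqrtr_sqr ler_sqrt ?addr_ge0 ?sqr_ge0// lerDr sqr_ge0.
Qed.

Lemma le_normc (z : R[i]) : Normc.normc z <= `|complex.Re z| + `|complex.Im z|.
Proof.
case: z => a b /=; rewrite -[leRHS]ger0_norm ?addr_ge0// -sqrtr_sqr.
rewrite ler_wsqrtr// sqrrD !real_normK ?num_real// addrAC lerDl.
by rewrite mulrn_wge0// mulr_ge0.
Qed.

Lemma normc_ge0 (z : R[i]) : 0 <= Normc.normc z.
Proof. by case: z => a b; exact: sqrtr_ge0. Qed.

Lemma Re_fourier (phi : Rn -> R[i]) xi : complex.Re (fourier phi xi) =
  fourier_re (fun x => complex.Re (phi x)) (fun x => complex.Im (phi x)) xi.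
Proof.
apply: eq_Rintegral => t _ /=; case: (phi _) => a b /=.
by rewrite /wave add0r cosD !sinN !cosN cos_pihalf sin_pihalf; ring.
Qed.

Lemma Im_fourier (phi : Rn -> R[i]) xi : complex.Im (fourier phi xi) =
  fourier_re (fun x => complex.Im (phi x)) (fun x => - complex.Re (phi x)) xi.
Proof.
apply: eq_Rintegral => t _ /=; case: (phi _) => a b /=.
by rewrite /wave add0r cosD !sinN !cosN cos_pihalf sin_pihalf; ring.
Qed.

End complex_values.

(** * Exchange of decay and regularity *)

Section transforms.
Context {R : realType} (n : nat).
Local Notation Rn := 'rV[R]_n.
Local Notation partials := (foldr (@partial R n)).

Let twopi_ge1 : 1 <= 2 * pi :> R.
Proof. by have := @pi_ge2 R; lra. Qed.

(** The phase of the integral to be estimated is arbitrary, so that integration by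
    parts can start from a phase that compensates its shifts. *)
Lemma int_wave_growth (f : Rn -> R) (S T : nat -> R) :
  (forall p q, (p <= q)%N -> S p <= S q) ->
  (forall p, 0 <= S p) -> (forall p, 0 <= T p) ->
  smooth_real f ->
  (forall a s x, ordered s ->
    `|monomial a x| * `|partials f s x| <= S (mlength a) * T (size s)) ->
  forall c b xi, `|monomial b xi| * `|int_Rn (fun x => f x * wave c x xi)| <=
    (2 ^+ n * S (2 * n)%N * int_Rn (@decay R n)) * T (mlength b).
Proof.
move=> Sle S0 T0 sf ST c b xi; set s := blocks b (enum 'I_n).
have os : ordered s by apply: ordered_blocks; exact: ordered_enum.
have fdecay s' x : ordered s' ->
    `|partials f s' x| <= 2 ^+ n * (S (2 * n)%N * T (size s')) * decay x.
  move=> os'; apply: decay_of_monomials => // a an.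
  by apply: le_trans (ST a s' x os') _; rewrite ler_wpM2r// Sle.
pose c' := c - (size s)%:R * (pi / 2).
have := @int_partials_wave R n f s c' xi sf.
have -> : c' + (size s)%:R * (pi / 2) = c by rewrite /c' subrK.
move=> H; have {H}E : int_Rn (fun x => partials f s x * wave c' x xi) =
    \prod_(j <- s) (- (2 * pi * xi ord0 j)) * int_Rn (fun x => f x * wave c x xi).
  apply: H => k; exists (2 ^+ n * (S (2 * n)%N * T (size (drop k s)))).
    by rewrite mulr_ge0// ?exprn_ge0// mulr_ge0.
  by move=> x; apply: fdecay; exact: ordered_drop.
have nE : `|\prod_(j <- s) (- (2 * pi * xi ord0 j))| =
    (2 * pi) ^+ size s * `|monomial b xi|.
  rewrite monomial_blocks -/s !normr_prod.
  elim: (s) => [|j s' IH]; first by rewrite !big_nil mulr1.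
  rewrite !big_cons IH /= exprS normrN normrM ger0_norm; first by ring.
  exact: le_trans twopi_ge1.
apply: (@le_trans _ _ `|int_Rn (fun x => partials f s x * wave c' x xi)|).
  rewrite E normrM nE -mulrA ler_peMl ?mulr_ge0//.
  by rewrite exprn_ege1.
apply: (@le_trans _ _ (int_Rn (fun x => 2 ^+ n * (S (2 * n)%N * T (size s)) * decay x))).
  apply: le_norm_int_Rn.
  - apply: continuous_measurable_tuple; apply: continuousM_wave.
    by have [] := sf s.
  - move=> x; rewrite normrM; apply: le_trans (fdecay s x os).
    by rewrite -[leRHS]mulr1 ler_wpM2l// norm_wave_le1.
  - exact/integrable_RnZ/integrable_decay.
rewrite int_RnZ; last exact: integrable_decay.
rewrite -size_blocks_enum -/s le_eqVlt; apply/orP; left; apply/eqP; ring.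
Qed.

Lemma fourier_re_split (u v : Rn -> R) M xi : continuous u -> continuous v ->
  (forall x, `|u x| <= M * decay x) -> (forall x, `|v x| <= M * decay x) ->
  fourier_re u v xi = int_Rn (fun x => u x * wave 0 x xi) +
                int_Rn (fun x => v x * wave (- (pi / 2)) x xi).
Proof.
have iw (f : Rn -> R) c : continuous f -> (forall x, `|f x| <= M * decay x) ->
    integrable_Rn (fun x => f x * wave c x xi).
  move=> cf fM; apply: (le_integrable_Rn _ _ (integrable_RnZ M (@integrable_decay R n))).
    by apply: continuous_measurable_tuple; exact: continuousM_wave.
  move=> x; rewrite normrM; apply: le_trans (fM x).
  by rewrite -[leRHS]mulr1 ler_wpM2l// norm_wave_le1.
by move=> cu cv uM vM; rewrite /fourier_re int_RnD//; exact: iw.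
Qed.

Lemma fourier_re_opp (u v : Rn -> R) M xi : continuous u -> continuous v ->
  (forall x, `|u x| <= M * decay x) -> (forall x, `|v x| <= M * decay x) ->
  fourier_re (fun x => - u x) (fun x => - v x) xi = - fourier_re u v xi.
Proof.
move=> cu cv uM vM; rewrite /fourier_re -[RHS]mulN1r -int_RnZ.
  by apply: eq_int_Rn => x; ring.
exact: (integrable_waves cu cv uM vM).
Qed.

(** By inversion u is a superposition of waves with the two parts of its transform as
    amplitudes. The inversion constant k is put into the amplitudes. *)
Lemma partials_growth (u v : Rn -> R) (M : R) (Z : nat -> R) :
  0 <= M -> continuous u -> continuous v ->
  (forall x, `|u x| <= M * decay x) -> (forall x, `|v x| <= M * decay x) ->
  (forall p, 0 <= Z p) ->
  (forall p q, (p <= q)%N -> Z p <= Z q) ->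
  (forall a xi, `|monomial a xi| * `|fourier_re u v xi| <= Z (mlength a)) ->
  (forall a xi, `|monomial a xi| * `|fourier_re v (fun x => - u x) xi| <= Z (mlength a)) ->
  forall s x, `|partials u s x| <=
   ((2 * pi) ^+ n / int_Rn (@cauchy_kernel R n) * 2 * 2 ^+ n * int_Rn (@decay R n)) *
    ((2 * pi) ^+ size s * Z (size s + 2 * n)%N).
Proof.
move=> M0 cu cv uM vM Z0 Zle hA hB s x.
pose k := (2 * pi) ^+ n / int_Rn (@cauchy_kernel R n).
have tp : 0 < 2 * pi :> R by exact: lt_le_trans twopi_ge1.
have k0 : 0 < k by rewrite divr_gt0// ?exprn_gt0// int_cauchy_gt0.
pose A := fourier_re u v; pose B := fourier_re v (fun x => - u x).
have cNu : continuous (fun x => - u x) by exact: continuous_oppr.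
have uNM y : `|- u y| <= M * decay y by rewrite normrN.
have mA : measurable_Rn A by exact: (measurable_fourier_re cu cv uM vM).
have mB : measurable_Rn B by exact: (measurable_fourier_re cv cNu vM uNM).
have ampE s' (xi : Rn) : `|\prod_(j <- s') (2 * pi * xi ord0 j)| =
    (2 * pi) ^+ size s' * `|monomial [ffun j => count_mem j s'] xi|.
  rewrite -monomial_count !normr_prod.
  elim: s' => [|j s' IH]; first by rewrite !big_nil mulr1.
  by rewrite !big_cons IH /= exprS normrM ger0_norm ?(ltW tp)//; ring.
have mono (s' : seq 'I_n) (F : Rn -> R) :
    (forall a xi, `|monomial a xi| * `|F xi| <= Z (mlength a)) ->
    forall xi : Rn, `|\prod_(j <- s') (2 * pi * xi ord0 j)| * `|F xi| <=
      2 ^+ n * ((2 * pi) ^+ size s' * Z (size s' + 2 * n)%N) * decay xi.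
  move=> hF xi; apply: decay_of_monomials => [|a an]; first exact: mulr_ge0.
  rewrite ampE -mulrA mulrCA ler_wpM2l ?exprn_ge0 ?(ltW tp)//.
  have -> : `|monomial a xi| * (`|monomial [ffun j => count_mem j s'] xi| * `|F xi|) =
      `|monomial [ffun j => (count_mem j s' + a j)%N] xi| * `|F xi|.
    rewrite mulrA -normrM -big_split /=; congr (`|_| * _).
    by apply: eq_bigr => j _; rewrite !ffunE exprD mulrC.
  apply: le_trans (hF _ _) _; apply: Zle.
  rewrite -mlength_count_mem /mlength.
  under eq_bigr do rewrite ffunE.
  by rewrite big_split /= leq_add//; apply: leq_sum => j _; rewrite ffunE.
have iF (F : Rn -> R) (s' : seq 'I_n) : measurable_Rn F ->
    (forall a xi, `|monomial a xi| * `|F xi| <= Z (mlength a)) ->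
    integrable_Rn (fun xi : Rn => \prod_(j <- s') (2 * pi * xi ord0 j) * (k * F xi)).
  move=> mF hF; apply: (le_integrable_Rn _ _ (integrable_RnZ
    (k * (2 ^+ n * ((2 * pi) ^+ size s' * Z (size s' + 2 * n)%N)))
    (@integrable_decay R n))).
    apply: measurable_funM; last by apply: measurable_funM.
    apply: measurable_prod => j _; apply: measurable_funM => //.
    exact: measurable_coord.
  move=> xi; rewrite mulrCA normrM (gtr0_norm k0) -[leRHS]mulrA ler_wpM2l ?(ltW k0)//.
  by rewrite normrM mono.
have uE : u = fun x => int_Rn (fun eta => \prod_(j <- [::]) (2 * pi * eta ord0 j) *
    (k * A eta * wave 0 x eta + k * B eta * wave (pi / 2) x eta)).
  apply/funext => y.
  have N0 : 0 <= 2 ^+ n * Z (2 * n)%N by rewrite mulr_ge0// exprn_ge0.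
  have AN xi : `|A xi| <= 2 ^+ n * Z (2 * n)%N * decay xi.
    by have := mono [::] _ hA xi; rewrite big_nil normr1 !mul1r.
  have BN xi : `|B xi| <= 2 ^+ n * Z (2 * n)%N * decay xi.
    by have := mono [::] _ hB xi; rewrite big_nil normr1 !mul1r.
  have := fourier_inversion M0 cu cv uM vM y N0 AN BN.
  move=> /(canRL (mulfK (lt0r_neq0 (int_cauchy_gt0 _)))) ->.
  rewrite mulrAC -/k -int_RnZ; last first.
    apply: (le_integrable_Rn _ _ (integrable_RnZ (2 ^+ n * Z (2 * n)%N +
      2 ^+ n * Z (2 * n)%N) (@integrable_decay R n))).
      by apply: measurable_funD; apply: measurable_funM => //; exact: measurable_wave.
    move=> xi.
    apply: le_trans (le_norm_mix _ _ (norm_wave_le1 _ _ _) (norm_wave_le1 _ _ _)) _.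
    by rewrite mulrDl lerD.
  by apply: eq_int_Rn => xi; rewrite big_nil /A /B; ring.
rewrite {1}uE.
have := @le_partials_superposition R n (fun xi => k * A xi) (fun xi => k * B xi)
  (fun s' => conj (iF A s' mA hA) (iF B s' mB hB)) s 0 (pi / 2) x.
move=> /le_trans; apply.
pose cst' := k * (2 ^+ n * ((2 * pi) ^+ size s * Z (size s + 2 * n)%N)).
have E (F : Rn -> R) : (forall a xi, `|monomial a xi| * `|F xi| <= Z (mlength a)) ->
    forall xi : Rn, `|\prod_(j <- s) (2 * pi * xi ord0 j) * (k * F xi)| <=
      cst' * decay xi.
  move=> hF xi; rewrite mulrCA normrM (gtr0_norm k0) /cst' -[leRHS]mulrA.
  rewrite ler_wpM2l ?(ltW k0)//.
  by rewrite normrM mono.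
have iA := integrable_abse (iF A s mA hA).
have iB := integrable_abse (iF B s mB hB).
apply: (@le_trans _ _ (int_Rn (fun xi => cst' * 2 * decay xi))).
  apply: le_trans (ler_norm _) _; apply: le_norm_int_Rn.
  - exact: measurable_integrable_Rn (integrable_RnD iA iB).
  - move=> xi; rewrite ger0_norm ?addr_ge0//.
    rewrite (_ : cst' * 2 * decay xi = cst' * decay xi + cst' * decay xi); last by ring.
    by rewrite lerD// E.
  - exact/integrable_RnZ/integrable_decay.
rewrite int_RnZ; last exact: integrable_decay.
rewrite le_eqVlt; apply/orP; left; apply/eqP; rewrite /cst' /k; ring.
Qed.

End transforms.

(** * The three conditions *)

Section conditions.
Context {R : realType} (n : nat) (sigma : R).
Hypothesis sigma_gt1 : 1 < sigma.
Local Notation Rn := 'rV[R]_n.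
Local Notation partials := (foldr (@partial R n)).
Local Notation W tau := (weight tau sigma).

Let zero : {ffun 'I_n -> nat} := [ffun=> 0%N].

Lemma mlength_zero : mlength zero = 0%N.
Proof. by rewrite /mlength big1// => j _; rewrite ffunE. Qed.

Lemma monomial_zero (x : Rn) : monomial zero x = 1.
Proof. by rewrite /monomial big1// => j _; rewrite ffunE expr0. Qed.

Lemma mpartial_zero (phi : Rn -> R[i]) : mpartial zero phi = phi.
Proof.
have E (f : Rn -> R) : mpartial_real zero f = f.
  rewrite mpartial_blocks; set s := blocks _ _.
  by have /size0nil -> : size s = 0%N by rewrite /s size_blocks_enum mlength_zero.
by apply/funext => x; rewrite /mpartial !E; case: (phi x).
Qed.

Variables (phi : Rn -> R[i]) (phi_smooth : smooth phi).
Let u x := complex.Re (phi x).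
Let v x := complex.Im (phi x).
Let su : smooth_real u. Proof. by case: phi_smooth. Qed.
Let sv : smooth_real v. Proof. by case: phi_smooth. Qed.
Let cu : continuous u. Proof. by have [] := su [::]. Qed.
Let cv : continuous v. Proof. by have [] := sv [::]. Qed.

Definition decay_cond (psi : Rn -> R[i]) (tau C : R) := forall a x,
  `|monomial a x| * Normc.normc (psi x) <= C * W tau (mlength a).

Definition derivative_cond (tau C : R) := forall b x,
  Normc.normc (mpartial b phi x) <= C * W tau (mlength b).

Lemma decay_condP psi tau C :
  (forall a, (supnorm (fun x => (monomial a x)%:C%C * psi x)%R <=
    (C * W tau (mlength a))%:E)%E) <-> decay_cond psi tau C.
Proof.
split=> H a; last by apply/supnorm_leP => x; rewrite normc_real.
by move=> x; have /supnorm_leP/(_ x) := H a; rewrite normc_real.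
Qed.

Lemma derivative_condP tau C :
  (forall b, (supnorm (mpartial b phi) <= (C * W tau (mlength b))%:E)%E) <->
  derivative_cond tau C.
Proof.
by split=> H b; [move=> x; have /supnorm_leP/(_ x) := H b|apply/supnorm_leP].
Qed.

Lemma normc_mpartial b x :
  Normc.normc (mpartial b phi x) <=
  `|partials u (blocks b (enum 'I_n)) x| + `|partials v (blocks b (enum 'I_n)) x|.
Proof. by apply: le_trans (le_normc _) _; rewrite /= !mpartial_blocks. Qed.

Lemma mixed_growth tau C : 0 < tau -> 0 < C ->
  decay_cond phi tau C -> derivative_cond tau C ->
  exists S T : nat -> R,
    [/\ (forall p q, (p <= q)%N -> S p <= S q),
        (forall p, 0 <= S p), (forall p, 0 <= T p), tame sigma S & tame sigma T] /\
    (forall f, f = u \/ f = v -> forall a s x, ordered s ->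
      `|monomial a x| * `|partials f s x| <= S (mlength a) * T (size s)).
Proof.
move=> tau0 C0 hd hp.
have C1 : 1 <= C + 1 by rewrite lerDr ltW.
have CW k : C * W tau k <= (C + 1) * W tau k.
  by rewrite ler_wpM2r ?weight_ge0// lerDl.
have CW0 k : 0 <= (C + 1) * W tau k.
  by rewrite mulr_ge0 ?weight_ge0// (le_trans ler01).
have L0 N : 0 <= landau_const n N :> R by rewrite (le_trans ler01)// landau_const_ge1.
have tCW : tame sigma (fun p => (C + 1) * W tau p).
  apply: tame_mul => //; [by rewrite (le_trans ler01)|
    by move=> p; exact: weight_ge0|exact: tame_cst|].
  by apply: tame_weight => //; exact: ltW.
exists (fun p => (C + 1) * W tau (2 * p)).
exists (fun p => landau_const n (2 * p) * ((C + 1) * W tau (2 * p))).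
split.
  split=> //.
  - move=> p q pq; rewrite ler_wpM2l ?(le_trans ler01)//.
    by rewrite weight_le ?(ltW tau0)// leq_mul2l.
  - by move=> p; rewrite mulr_ge0.
  - exact: (tame_comp_mul (isT : (0 < 2)%N) tCW).
  - apply: tame_mul => //; first exact: tame_landau_const.
    exact: (tame_comp_mul (isT : (0 < 2)%N) tCW).
move=> f fuv; apply: mixed_bound => //.
- by case: fuv => ->.
- move=> a x; apply: le_trans (CW _); apply: le_trans (hd a x).
  by rewrite ler_wpM2l//; case: fuv => ->; [exact: ge_normc_Re|exact: ge_normc_Im].
- move=> s x os; apply: le_trans (CW _).
  rewrite -(mlength_count_mem s); apply: le_trans (hp _ x).
  rewrite (partials_ordered _ os).
  case: fuv => ->; first exact: (ge_normc_Re (mpartial _ phi x)).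
  exact: (ge_normc_Im (mpartial _ phi x)).
Qed.

Lemma gelfand_shilov_of_derivatives tau C : 0 < tau -> 0 < C ->
  decay_cond phi tau C -> derivative_cond tau C -> gelfand_shilov sigma phi.
Proof.
move=> tau0 C0 hd hp.
have [S [T [[_ S0 T0 tS tT] ST]]] := mixed_growth tau0 C0 hd hp.
have [t t0 [D D1 STD]] := tame_pair tS tT.
have D0 : 0 < D by exact: lt_le_trans D1.
split=> //; exists t => //; exists (2 * D * D); first by rewrite !mulr_gt0.
move=> a b; apply/supnorm_leP => x; rewrite normc_real.
apply: le_trans (ler_wpM2l (normr_ge0 _) (normc_mpartial b x)) _.
have ob : ordered (blocks b (enum 'I_n)) by apply: ordered_blocks; exact: ordered_enum.
have h : S (mlength a) * T (mlength b) <=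
    (D * W t (mlength a)) * (D * W t (mlength b)).
  by apply: ler_pM => //; [exact: (STD _).1|exact: (STD _).2].
rewrite mulrDr.
have := lerD (ST u (or_introl erefl) a _ x ob) (ST v (or_intror erefl) a _ x ob).
rewrite size_blocks_enum => /le_trans; apply.
apply: le_trans (lerD h h) _.
by rewrite le_eqVlt; apply/orP; left; apply/eqP; ring.
Qed.

Lemma fourier_growth tau C : 0 < tau -> 0 < C ->
  decay_cond phi tau C -> derivative_cond tau C ->
  exists2 t, 0 < t & exists2 D, 0 < D &
    decay_cond phi t D /\ decay_cond (fourier phi) t D.
Proof.
move=> tau0 C0 hd hp.
have [S [T [[Sle S0 T0 tS tT] ST]]] := mixed_growth tau0 C0 hd hp.
pose K := 2 ^+ n * S (2 * n)%N * int_Rn (@decay R n).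
have wu := int_wave_growth Sle S0 T0 su (ST u (or_introl erefl)).
have wv := int_wave_growth Sle S0 T0 sv (ST v (or_intror erefl)).
have K0 : 0 <= K.
  rewrite !mulr_ge0 ?exprn_ge0//; apply: Rintegral_ge0 => t _; exact: decay_ge0.
have tCW : tame sigma (fun p => C * W tau p).
  apply: tame_mul => //; [by move=> _; exact: ltW|
    by move=> p; exact: weight_ge0|exact: tame_cst|].
  by apply: tame_weight => //; exact: ltW.
have tKT : tame sigma (fun p => 4 * K * T p).
  apply: tame_mul => //; [by move=> _; rewrite mulr_ge0|exact: tame_cst].
have [t t0 [D D1 CKD]] := tame_pair tCW tKT.
exists t => //; exists D; first exact: lt_le_trans D1.
split=> [a x|b xi]; first exact: le_trans (hd a x) (CKD _).1.
apply: le_trans (CKD _).2.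
apply: le_trans (ler_wpM2l (normr_ge0 _) (le_normc _)) _.
rewrite Re_fourier Im_fourier -/u -/v.
have uM x : `|u x| <= 2 ^+ n * (S (2 * n)%N * T 0%N) * decay x.
  apply: decay_of_monomials => // a an.
  by apply: le_trans (ST u (or_introl erefl) a [::] x isT) _; rewrite ler_wpM2r// Sle.
have vM x : `|v x| <= 2 ^+ n * (S (2 * n)%N * T 0%N) * decay x.
  apply: decay_of_monomials => // a an.
  by apply: le_trans (ST v (or_intror erefl) a [::] x isT) _; rewrite ler_wpM2r// Sle.
have cNu : continuous (fun x => - u x) by exact: continuous_oppr.
have uNM y : `|- u y| <= 2 ^+ n * (S (2 * n)%N * T 0%N) * decay y by rewrite normrN.
rewrite (fourier_re_split _ cu cv uM vM) (fourier_re_split _ cv cNu vM uNM).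
have -> : int_Rn (fun x => - u x * wave (- (pi / 2)) x xi) =
    - int_Rn (fun x => u x * wave (- (pi / 2)) x xi).
  rewrite -[RHS]mulN1r -int_RnZ; first by apply: eq_int_Rn => x; ring.
  apply: (le_integrable_Rn _ _ (integrable_RnZ (2 ^+ n * (S (2 * n)%N * T 0%N))
    (@integrable_decay R n))).
    by apply: continuous_measurable_tuple; exact: continuousM_wave.
  move=> x; rewrite normrM; apply: le_trans (uM x).
  by rewrite -[leRHS]mulr1 ler_wpM2l// norm_wave_le1.
apply: (@le_trans _ _ (`|monomial b xi| * ((`|int_Rn (fun x => u x * wave 0 x xi)| +
   `|int_Rn (fun x => v x * wave (- (pi / 2)) x xi)|) +
   (`|int_Rn (fun x => v x * wave 0 x xi)| +
   `|int_Rn (fun x => u x * wave (- (pi / 2)) x xi)|)))).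
  by rewrite ler_wpM2l//; apply: lerD; [exact: ler_normD|exact: ler_normB].
rewrite !mulrDr.
have := lerD (lerD (wu 0 b xi) (wv (- (pi / 2)) b xi))
  (lerD (wv 0 b xi) (wu (- (pi / 2)) b xi)).
move=> /le_trans; apply; rewrite -/K.
by rewrite le_eqVlt; apply/orP; left; apply/eqP; ring.
Qed.

(** The imaginary part v of phi is the real part of - i phi = v - i u, whose
    transform has the real part [fourier_re v (- u)] and the imaginary part
    [- fourier_re u v]. *)
Lemma derivative_growth tau C : 0 < tau -> 0 < C ->
  decay_cond phi tau C -> decay_cond (fourier phi) tau C ->
  exists2 t, 0 < t & exists2 D, 0 < D &
    decay_cond phi t D /\ derivative_cond t D.
Proof.
move=> tau0 C0 hd hf.
pose Z p := C * W tau p.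
have Z0 p : 0 <= Z p by rewrite mulr_ge0 ?weight_ge0// ltW.
have Zle p q : (p <= q)%N -> Z p <= Z q.
  by move=> pq; rewrite ler_wpM2l ?(ltW C0)// weight_le// ltW.
pose M := 2 ^+ n * Z (2 * n)%N.
have M0 : 0 <= M by rewrite mulr_ge0// exprn_ge0.
have phiM x : Normc.normc (phi x) <= M * decay x.
  apply: decay_of_monomials; first exact: normc_ge0.
  by move=> a an; apply: le_trans (hd a x) _; exact: Zle.
have uM x : `|u x| <= M * decay x by apply: le_trans (phiM x); exact: ge_normc_Re.
have vM x : `|v x| <= M * decay x by apply: le_trans (phiM x); exact: ge_normc_Im.
have cNu : continuous (fun x => - u x) by exact: continuous_oppr.
have uNM y : `|- u y| <= M * decay y by rewrite normrN.
have hA a xi : `|monomial a xi| * `|fourier_re u v xi| <= Z (mlength a).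
  apply: le_trans (hf a xi); rewrite ler_wpM2l// -Re_fourier; exact: ge_normc_Re.
have hB a xi : `|monomial a xi| * `|fourier_re v (fun x => - u x) xi| <= Z (mlength a).
  apply: le_trans (hf a xi); rewrite ler_wpM2l// -Im_fourier; exact: ge_normc_Im.
have hA' a xi : `|monomial a xi| * `|fourier_re (fun x => - u x) (fun x => - v x) xi| <=
    Z (mlength a).
  by rewrite (fourier_re_opp _ cu cv uM vM) normrN.
have gu := partials_growth M0 cu cv uM vM Z0 Zle hA hB.
have gv := partials_growth M0 cv cNu vM uNM Z0 Zle hB hA'.
set K : R := _ / _ * _ * _ * _ in gu gv.
have K0 : 0 <= K.
  have p0 : 0 <= 2 * pi :> R by rewrite mulr_ge0// pi_ge0.
  rewrite !mulr_ge0 ?exprn_ge0// ?invr_ge0 ?(ltW (int_cauchy_gt0 _))//.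
  by apply: Rintegral_ge0 => t _; exact: decay_ge0.
have tZ : tame sigma Z.
  apply: tame_mul => //; [by move=> _; exact: ltW|
    by move=> p; exact: weight_ge0|exact: tame_cst|].
  by apply: tame_weight => //; exact: ltW.
have twopi_ge1 : 1 <= 2 * pi :> R by have := @pi_ge2 R; lra.
have e0 p : 0 <= (2 * pi) ^+ p :> R by rewrite exprn_ge0// (le_trans ler01).
have tK : tame sigma (fun p => 2 * K * ((2 * pi) ^+ p * Z (p + 2 * n)%N)).
  apply: tame_mul => //.
  - by move=> _; rewrite mulr_ge0.
  - by move=> p; rewrite mulr_ge0.
  - exact: tame_cst.
  apply: tame_mul => //; first exact: tame_geometric.
  exact: tame_comp_add.
have [t t0 [D D1 ZKD]] := tame_pair tZ tK.
exists t => //; exists D; first exact: lt_le_trans D1.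
split=> [a x|b x]; first exact: le_trans (hd a x) (ZKD _).1.
apply: le_trans (ZKD _).2; apply: le_trans (normc_mpartial b x) _.
apply: le_trans (lerD (gu _ x) (gv _ x)) _.
rewrite size_blocks_enum.
by rewrite le_eqVlt; apply/orP; left; apply/eqP; ring.
Qed.

End conditions.

Theorem theorem4p3 (R : realType) (n : nat) (sigma : R)
    (sigma_gt1 : 1 < sigma) (phi : 'rV[R]_n -> R[i]) (phi_smooth : smooth phi) :
  let cond1 := gelfand_shilov sigma phi in
  let cond2 :=
    exists2 tau : R, 0 < tau & exists2 C : R, 0 < C &
      forall a b : {ffun 'I_n -> nat},
        (supnorm (fun x => (monomial a x)%:C%C * phi x)%R <=
           (C * weight tau sigma (mlength a))%:E)%E /\
        (supnorm (mpartial b phi) <=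
           (C * weight tau sigma (mlength b))%:E)%E in
  let cond3 :=
    exists2 tau : R, 0 < tau & exists2 C : R, 0 < C &
      forall a b : {ffun 'I_n -> nat},
        (supnorm (fun x => (monomial a x)%:C%C * phi x)%R <=
           (C * weight tau sigma (mlength a))%:E)%E /\
        (supnorm (fun xi => (monomial b xi)%:C%C * fourier phi xi)%R <=
           (C * weight tau sigma (mlength b))%:E)%E in
  (cond1 <-> cond2) /\ (cond2 <-> cond3).
Proof.
pose o : {ffun 'I_n -> nat} := [ffun=> 0%N].
split; split.
- move=> [_ [tau tau0 [C C0 H]]]; exists tau => //; exists C => // a b; split.
    by have := H a o; rewrite mpartial_zero mlength_zero /= mulr1.
  have := H o b; rewrite mlength_zero /= mulr1.
  by under eq_fun do rewrite monomial_zero mul1r.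
- move=> [tau tau0 [C C0 H]].
  apply: (gelfand_shilov_of_derivatives sigma_gt1 phi_smooth tau0 C0).
    by apply/decay_condP => a; have [] := H a o.
  by apply/derivative_condP => b; have [] := H o b.
- move=> [tau tau0 [C C0 H]].
  have [||t t0 [D D0 [/decay_condP h1 /decay_condP h2]]] :=
      @fourier_growth R n sigma sigma_gt1 phi phi_smooth tau C tau0 C0.
  + by apply/decay_condP => a; have [] := H a o.
  + by apply/derivative_condP => b; have [] := H o b.
  by exists t => //; exists D.
- move=> [tau tau0 [C C0 H]].
  have [||t t0 [D D0 [/decay_condP h1 /derivative_condP h2]]] :=
      @derivative_growth R n sigma sigma_gt1 phi phi_smooth tau C tau0 C0.
  + by apply/decay_condP => a; have [] := H a o.
  + by apply/decay_condP => b; have [] := H o b.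
  by exists t => //; exists D.
Qed.
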